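(* Let $X$ be a Polish space. Then every Baire measure on $X$ is a $k$-regular measure and hence the notions of Baire, Radon and $k$-regular measure on $X$ all coincide. Moreover, the topology on $\mathcal{P}(X)$ is given by the topology of weak convergence of measures, and $\mathcal{P}(X)$ is again a Polish space.
   Context: $\mathbb{K}$ denotes $\mathbb{R}$ or $\mathbb{C}$; measures are countably additive, $\mathbb{K}$-valued and of bounded variation. A topological space $X$ is a $k$-space if every map $f:X\to Y$ to a topological space $Y$, such that $f\circ p$ is continuous for every continuous $p:K\to X$ with $K$ compact Hausdorff, is continuous (metrisable spaces are $k$-spaces). The $k$-ification $kX$ of a topological space $X$ is the set $X$ with the topology whose open sets are those $U$ for which $p^{-1}(U)$ is open for every continuous $p:K\to X$ from a compact Hausdorff space $K$. The product $X\times Y$ of $k$-spaces always means $k(X\times_{\mathsf{Top}}Y)$. An $hk$-space is a $k$-space $X$ whose diagonal is closed in $X\times X$; $\mathsf{hkTop}$ is the category of $hk$-spaces and continuous maps. For $hk$-spaces $X,Y$, $C(X,Y)$ is the $k$-ification of the set of continuous maps $X\to Y$ with the compact-open topology. A linear $hk$-space is an $hk$-space $V$ with a $\mathbb{K}$-vector space structure whose operations $V\times V\to V$, $\mathbb{K}\times V\to V$ are continuous; its natural dual $V^\wedge$ is the closed subspace of $C(V,\mathbb{K})$ of continuous linear functionals. $C_b(X)$ is the linear $hk$-space of bounded continuous functions $X\to\mathbb{K}$, topologised as the filtered colimit in $\mathsf{hkTop}$ of the spaces $C(X,nD)$, $n\in\mathbb{N}$, along inclusions, where $D\subseteq\mathbb{K}$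 is the closed unit disk. $\mathcal{M}(X)$ is the closed linear span in $C_b(X)^\wedge$ of the Dirac functionals $\delta_x(f)=f(x)$. A Baire measure is a measure on the Baire $\sigma$-algebra (generated by the continuous $\mathbb{K}$-valued functions). A Radon measure is a Borel measure $\mu$ such that for every $\varepsilon>0$ there is a compact $K_\varepsilon$ with $|\mu|(X\setminus K_\varepsilon)<\varepsilon$. (On a Polish space the Baire and Borel $\sigma$-algebras agree.) A $k$-regular measure on an $hk$-space $X$ is a Baire measure $\mu$ such that the functional $f\mapsto\int f\,\mathrm{d}\mu$ on $C_b(X)$ belongs to $\mathcal{M}(X)$; $k$-regular measures are identified with the elements of $\mathcal{M}(X)$. $\mathcal{P}(X)=\{\mu\in\mathcal{M}(X)\mid\mu\ge0,\ \mu(1)=1\}$ is the closed subspace of $k$-regular probability measures. A net $(\mu_i)$ converges weakly to $\mu$ if $\int f\,\mathrm{d}\mu_i\to\int f\,\mathrm{d}\mu$ for all $f\in C_b(X)$. *)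

(* Defs.v *)
From HB Require Import structures.
From mathcomp Require Import all_boot all_order all_algebra.
From mathcomp Require Import complex.
From mathcomp Require Import all_classical all_reals all_analysis.

Set Implicit Arguments.
Unset Strict Implicit.
Unset Printing Implicit Defensive.

Import Order.TTheory GRing.Theory Num.Theory.
Import numFieldNormedType.Exports.

Local Open Scope classical_set_scope.
Local Open Scope ring_scope.

Variant scalar_kind := RealScalars | ComplexScalars.

Definition scalars (R : realType) (k : scalar_kind) : numFieldType :=
  match k with
  | RealScalars => R : numFieldType
  | ComplexScalars => R[i] : numFieldType
  end.

(* The norm of a [numFieldType] takes its values in the field itself; this is
   the same norm with values in [R]. *)
Definition absR (R : realType) (k : scalar_kind) : scalars R k -> R :=
  match k return scalars R k -> R with
  | RealScalars => fun x : R => `|x|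
  | ComplexScalars => fun z : R[i] => complex.Re `|z|
  end.

Definition separable (T : topologicalType) : Prop :=
  exists2 D : set T, countable D & dense D.

Definition completely_metrizable (R : realType) (T : topologicalType) : Prop :=
  exists (M : metricType R) (h : T -> M) (g : M -> T),
    [/\ cancel h g, cancel g h, continuous h, continuous g
      & forall F : set_system M, ProperFilter F -> cauchy F ->
          exists l : M, F --> l].

Definition polish (R : realType) (T : topologicalType) : Prop :=
  separable T /\ completely_metrizable R T.

Definition kify (X : topologicalType) : Type := X.

Section kify_topology.
Variable X : topologicalType.

Definition kopen (U : set X) : Prop :=
  forall (K : topologicalType) (p : K -> X),
    compact [set: K] -> hausdorff_space K -> continuous p -> open (p @^-1` U).

Lemma kopenT : kopen setT.
Proof. by move=> K p _ _ _; rewrite preimage_setT; exact: openT. Qed.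

Lemma kopenI : setI_closed kopen.
Proof.
move=> A B kA kB K p cK hK cp; rewrite preimage_setI.
by apply: openI; [exact: kA | exact: kB].
Qed.

Lemma kopen_bigU (I : Type) (f : I -> set X) :
  (forall i, kopen (f i)) -> kopen (\bigcup_i f i).
Proof.
move=> kf K p cK hK cp; rewrite preimage_bigcup.
by apply: bigcup_open => i _; exact: kf.
Qed.

HB.instance Definition _ := Choice.on (kify X).
HB.instance Definition _ :=
  isOpenTopological.Build (kify X) kopenT kopenI kopen_bigU.

End kify_topology.

(* Continuous maps with the compact-open topology, before k-ification. *)
Definition cptopen_maps (X Y : topologicalType) : topologicalType :=
  initial_topology
    ((fun f => f : X -> Y) : continuousType X Y -> {compact-open, X -> Y}).

Definition Cmaps (X Y : topologicalType) : topologicalType :=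
  kify (cptopen_maps X Y).

Definition cmap_fun (X Y : topologicalType) (f : Cmaps X Y) : X -> Y :=
  (f : continuousType X Y).

Section Cb.
Variables (K : numFieldType) (X : topologicalType).

Definition bounded_continuous : {pred X -> K} :=
  fun f => `[< continuous f /\ bounded_fun f >].

Lemma bounded_continuousP (f : X -> K) : reflect
  (continuous f /\ exists M : K, forall x, `|f x| <= M) (f \in bounded_continuous).
Proof.
apply: (iffP idP).
  move=> /asboolP[cf [N [_ fN]]]; split=> //.
  by exists (N + 1) => x; apply: fN => //; rewrite ltrDl.
move=> [cf [M fM]]; apply/asboolP; split=> //.
exists `|M|; split; first exact: normr_real.
move=> N MN x _; apply: (le_trans (fM x)).
rewrite ltW//; apply: le_lt_trans MN.
by rewrite real_ler_norm// (ger0_real (le_trans (normr_ge0 _) (fM x))).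
Qed.

Fact bounded_continuous_submod : submod_closed bounded_continuous.
Proof.
split.
  apply/bounded_continuousP; split; first exact: cst_continuous.
  by exists 0 => x; rewrite normr0.
move=> a f g /bounded_continuousP[cf [M fM]] /bounded_continuousP[cg [N gN]].
apply/bounded_continuousP; split.
  move=> x; apply: (@cvgD _ _ _ (nbhs x) _ (fun y => a * f y) g (a * f x) (g x)).
    by apply: cvgM; [exact: cvg_cst | exact: cf].
  exact: cg.
exists (`|a| * M + N) => x.
rewrite (le_trans (ler_normD _ _))// lerD// normrM.
by rewrite ler_wpM2l.
Qed.

HB.instance Definition _ :=
  GRing.isSubmodClosed.Build K (X -> K) bounded_continuous
    bounded_continuous_submod.

Record Cb := MkCb {Cb_fun :> X -> K; _ : Cb_fun \in bounded_continuous}.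

HB.instance Definition _ := [isSub for Cb_fun].
HB.instance Definition _ := [Choice of Cb by <:].
HB.instance Definition _ := [SubChoice_isSubLmodule of Cb by <:].

Fact Cb_one_subproof : (fun _ : X => 1 : K) \in bounded_continuous.
Proof.
apply/bounded_continuousP; split; first exact: cst_continuous.
by exists 1 => x; rewrite normr1.
Qed.

Definition Cb_one : Cb := MkCb Cb_one_subproof.

(* The disk [n D]; [set_type] gives it the subspace topology. *)
Definition disk (n : nat) : set K := [set z | `|z| <= n%:R].

Definition disk_maps (n : nat) : topologicalType := Cmaps X (set_type (disk n)).

Fact Cb_incl_subproof n (f : disk_maps n) :
  (fun x => set_val (cmap_fun f x)) \in bounded_continuous.
Proof.
apply/bounded_continuousP; split.
  move=> x; apply: (@continuous_comp _ _ _ (cmap_fun f) set_val).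
    exact: (@cts_fun _ _ (f : continuousType _ _)).
  exact: initial_continuous.
by exists n%:R => x; exact: (set_valP (cmap_fun f x)).
Qed.

Definition Cb_incl n (f : disk_maps n) : Cb := MkCb (Cb_incl_subproof f).

(* The filtered colimit of the [C(X, n D)] along the (jointly surjective)
   inclusions: their union with the final topology. This is already the colimit
   in hk-spaces: a final topology over k-spaces is a k-topology, and it is
   Hausdorff because evaluation at each point of [X] is continuous. *)
Definition Cb_open (U : set Cb) : Prop :=
  forall n, open ((@Cb_incl n) @^-1` U).

Lemma Cb_openT : Cb_open setT.
Proof. by move=> n; rewrite preimage_setT; exact: openT. Qed.

Lemma Cb_openI : setI_closed Cb_open.
Proof. by move=> A B oA oB n; rewrite preimage_setI; exact: openI. Qed.

Lemma Cb_open_bigU (I : Type) (f : I -> set Cb) :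
  (forall i, Cb_open (f i)) -> Cb_open (\bigcup_i f i).
Proof.
move=> of_ n; rewrite preimage_bigcup.
by apply: bigcup_open => i _; exact: of_.
Qed.

HB.instance Definition _ :=
  isOpenTopological.Build Cb Cb_openT Cb_openI Cb_open_bigU.

End Cb.

(* Linear functionals form a closed subset of [Cmaps V K], so the subspace
   topology needs no further k-ification. *)
Definition natural_dual_set (K : numFieldType) (V : preTopologicalLmodType K) :
    set (Cmaps V K) :=
  [set phi : Cmaps V K | scalar (cmap_fun phi : V -> K)].

Definition natural_dual (K : numFieldType) (V : preTopologicalLmodType K) :
    topologicalType :=
  set_type (@natural_dual_set K V).

Definition natural_dual_fun (K : numFieldType) (V : preTopologicalLmodType K)
    (phi : natural_dual V) : V -> K :=
  cmap_fun (set_val phi).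

Section MP.
Variables (K : numFieldType) (X : topologicalType).

Definition dirac_span : set (natural_dual (Cb K X)) :=
  [set phi | exists (n : nat) (a : 'I_n -> K) (x : 'I_n -> X),
     forall f : Cb K X, natural_dual_fun phi f = \sum_(i < n) a i * f (x i)].

(* The closed linear span: the closure of a linear subspace is linear, since
   translations and homotheties are continuous. *)
Definition Mspace : set (natural_dual (Cb K X)) := closure dirac_span.

(* In the type [R[i]], [0 <= z] means that [z] is real and nonnegative.
   [Mspace] and [Pset] are closed in the dual, so the subspace topology below is
   already a k-topology. *)
Definition Pset : set (natural_dual (Cb K X)) :=
  [set phi | [/\ Mspace phi,
     forall f : Cb K X, (forall x, 0 <= f x) -> 0 <= natural_dual_fun phi f
     & natural_dual_fun phi (Cb_one K X) = 1]].

Definition Pspace : topologicalType := set_type Pset.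

(* The integral of [f] against an element of [P(X)]; elements of [M(X)] are
   identified with k-regular measures through their integration functionals. *)
Definition P_int (mu : Pspace) (f : Cb K X) : K :=
  natural_dual_fun (set_val mu) f.

(* Weak convergence along a filter on an index type; a net is the case of the
   filter of tails of a directed index set. *)
Definition weak_cvg (I : Type) (F : set_system I)
    (mu_ : I -> Pspace) (mu : Pspace) : Prop :=
  forall f : Cb K X, P_int (mu_ i) f @[i --> F] --> P_int mu f.

End MP.

(* The integration theory of the library needs a pointed carrier and measures
   valued in the extended reals; here [X] may be empty and measures are
   scalar-valued set functions. Only their values on the relevant sigma-algebra
   matter. *)
Section measures.
Variables (R : realType) (k : scalar_kind) (X : topologicalType).
Local Notation K := (scalars R k).
Implicit Types (S : set (set X)) (mu : set X -> K).

Definition baire_sets : set (set X) :=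
  <<s [set A | exists (f : X -> K) (U : set K),
        [/\ continuous f, open U & A = f @^-1` U] ] >>.

Definition borel_sets : set (set X) := <<s @open X >>.

Definition finite_partition S (A : set X) n (F : 'I_n -> set X) : Prop :=
  [/\ forall i, S (F i), trivIset setT F & \bigcup_i F i = A].

Definition scalar_variation S mu (A : set X) : \bar R :=
  ereal_sup [set v | exists (n : nat) (F : 'I_n -> set X),
    finite_partition S A F /\ v = (\sum_(i < n) absR (mu (F i)))%:E].

Definition countably_additive S mu : Prop :=
  forall F : nat -> set X, (forall i, S (F i)) -> trivIset setT F ->
    (fun n => \sum_(i < n) mu (F i)) @ \oo --> mu (\bigcup_i F i).

Definition is_measure S mu : Prop :=
  countably_additive S mu /\ (scalar_variation S mu setT < +oo)%E.

Definition baire_measure mu : Prop := is_measure baire_sets mu.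

Definition radon_measure mu : Prop :=
  is_measure borel_sets mu /\
  forall e : R, 0 < e ->
    exists2 C : set X, compact C &
      (scalar_variation borel_sets mu (~` C) < e%:E)%E.

(* [v] is the integral of the bounded [S]-measurable function [f] against [mu]:
   [f] is a uniform limit of simple functions [\sum_i c i * \1_(F i)] whose
   integrals [\sum_i c i * mu (F i)] converge to [v]. Such a [v] is unique when
   [mu] has bounded variation. *)
Definition has_integral S mu (f : X -> K) (v : K) : Prop :=
  forall e : K, 0 < e ->
    exists (n : nat) (F : 'I_n -> set X) (c : 'I_n -> K),
      [/\ finite_partition S setT F,
          forall i x, F i x -> `|f x - c i| <= e
        & `|v - \sum_(i < n) c i * mu (F i)| <= e].

Definition k_regular_measure mu : Prop :=
  baire_measure mu /\
  exists2 phi : natural_dual (Cb K X), Mspace phi &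
    forall f : Cb K X, has_integral baire_sets mu f (natural_dual_fun phi f).

End measures.

Arguments baire_sets R k X : clear implicits.
Arguments borel_sets X : clear implicits.

(* Main.v *)
Require Import Defs.
From HB Require Import structures.
From mathcomp Require Import all_boot all_order all_algebra.
From mathcomp Require Import complex.
From mathcomp Require Import all_classical all_reals all_analysis.
From mathcomp Require Import ring lra.

Set Implicit Arguments.
Unset Strict Implicit.
Unset Printing Implicit Defensive.

Import Order.TTheory GRing.Theory Num.Theory.
Import numFieldNormedType.Exports.

Local Open Scope classical_set_scope.
Local Open Scope ring_scope.


(** Why the theorem holds. The bridge between measures and k-topologies is the
    notion [smooth]: a functional on [Cb K X] is smooth if it is small, uniformly,
    on everything dominated by a late term of a sequence of functions decreasing
    pointwise to 0. Integration against a measure is smooth by countable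
    additivity ([integral_fun_smooth]), and Dini's theorem shows that every
    element of the natural dual of [Cb K X] is smooth ([natural_dual_smooth]).

    Conversely, a smooth linear functional belongs to [M(X)] ([smooth_Mspace]).
    Take a partition of unity made of tents around finitely many points of a
    dense sequence and of a remainder. Replacing [f] by its values at the centres
    of the tents turns the functional into a combination of Dirac functionals; the
    error comes from [f] times the remainder and from the oscillation of [f] at
    the scale of the tents. A compact set of test functions is bounded and
    equicontinuous, so its oscillations have a common continuous majorant, which
    decreases to 0 with the scale ([oscillation_envelope]). By smoothness a
    sequence of Dirac combinations converges uniformly on compact sets, and
    k-ification does not destroy the convergence of a sequence, because a sequence
    with its limit is an image of the one-point compactification of the integers
    ([kify_cvg_seq]). Hence Baire measures are k-regular; they are Radon by the
    argument of Ulam ([borel_tight]).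

    On [P(X)] the same approximation compares two positive functionals through
    finitely many test functions ([compare_by_parts]), so weak convergence is
    uniform on bounded equicontinuous sets ([weak_cvg_unif]). For sequences this
    gives convergence in the k-topology; for arbitrary filters it gives
    convergence in the bounded Lipschitz metric. Conversely, metric convergence
    implies weak convergence, since bounded continuous functions are increasing
    limits of Lipschitz ones ([BL_cvg_weak]). Sequences determine a metric
    topology, so the three topologies agree ([nbhs_Pspace]).

    The bounded Lipschitz metric is complete: along a Cauchy filter the truncated
    distances to finite sets of dense points are uniformly small, and completeness
    of [X] turns this into smoothness uniform along the filter ([cauchy_smooth]).
    So expectations of all bounded continuous functions converge, and their limit
    is smooth. Rounding the finitely many masses that control the distance gives
    separability ([Pspace_BL_separable]). *)

(** * Scalars *)

Section scalar_embedding.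
Variables (R : realType) (k : scalar_kind).
Local Notation K := (scalars R k).

Definition ofR : R -> K :=
  match k return R -> scalars R k with
  | RealScalars => fun x => x
  | ComplexScalars => fun x => (x%:C)%C
  end.

Definition reK : K -> R :=
  match k return scalars R k -> R with
  | RealScalars => fun x => x
  | ComplexScalars => fun z : R[i] => complex.Re z
  end.

Definition imK : K -> R :=
  match k return scalars R k -> R with
  | RealScalars => fun _ => 0
  | ComplexScalars => fun z : R[i] => complex.Im z
  end.

(** The imaginary unit, or 0 over the reals, so that [K_decomp] treats both kinds
    of scalars at once. *)
Definition jK : K :=
  match k return scalars R k with
  | RealScalars => 0 : R
  | ComplexScalars => ('i)%C : R[i]
  end.

End scalar_embedding.

Arguments ofR {R k}.
Arguments reK {R k}.
Arguments imK {R k}.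
Arguments jK {R k}.

Section scalar_theory.
Variables (R : realType) (k : scalar_kind).
Local Notation K := (scalars R k).
Implicit Types (x y : R) (z w : K).

Lemma ofRD x y : ofR (x + y) = ofR x + ofR y :> K.
Proof. by rewrite /ofR; case: k => //=; rewrite rmorphD. Qed.
Lemma ofRM x y : ofR (x * y) = ofR x * ofR y :> K.
Proof. by rewrite /ofR; case: k => //=; rewrite rmorphM. Qed.
Lemma ofRN x : ofR (- x) = - ofR x :> K.
Proof. by rewrite /ofR; case: k => //=; rewrite rmorphN. Qed.
Lemma ofR0 : ofR 0 = 0 :> K.
Proof. by rewrite /ofR; case: k. Qed.
Lemma ofR1 : ofR 1 = 1 :> K.
Proof. by rewrite /ofR; case: k. Qed.
Lemma ofRB x y : ofR (x - y) = ofR x - ofR y :> K.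
Proof. by rewrite ofRD ofRN. Qed.
Lemma ofR_sum (I : Type) (r : seq I) (P : pred I) (F : I -> R) :
  ofR (\sum_(i <- r | P i) F i) = \sum_(i <- r | P i) ofR (F i) :> K.
Proof.
by elim/big_rec2 : _ => [|i y1 y2 _ <-]; rewrite ?ofR0// ofRD.
Qed.
Lemma ofR_nat n : ofR n%:R = n%:R :> K.
Proof. by elim: n => [|n IH]; rewrite ?ofR0// -addn1 !natrD ofRD IH ofR1. Qed.

Lemma ler_ofR x y : (ofR x <= ofR y :> K) = (x <= y).
Proof. by rewrite /ofR; case: k => //=; rewrite lecR. Qed.
Lemma ltr_ofR x y : (ofR x < ofR y :> K) = (x < y).
Proof. by rewrite /ofR; case: k => //=; rewrite ltcR. Qed.

Lemma reKD z w : reK (z + w) = reK z + reK w.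
Proof. by move: z w; rewrite /reK; case: k => //= -[a b] [c d]. Qed.
Lemma imKD z w : imK (z + w) = imK z + imK w.
Proof. by move: z w; rewrite /imK; case: k => //= [_ _|[a b] [c d]//]; rewrite addr0. Qed.
Lemma reKN z : reK (- z) = - reK z.
Proof. by move: z; rewrite /reK; case: k => //= -[a b]. Qed.
Lemma imKN z : imK (- z) = - imK z.
Proof. by move: z; rewrite /imK; case: k => //= [_|[a b]//]; rewrite oppr0. Qed.
Lemma reKB z w : reK (z - w) = reK z - reK w.
Proof. by rewrite reKD reKN. Qed.
Lemma imKB z w : imK (z - w) = imK z - imK w.
Proof. by rewrite imKD imKN. Qed.
Lemma reK_ofR x : reK (ofR x : K) = x.
Proof. by rewrite /reK /ofR; case: k. Qed.
Lemma imK_ofR x : imK (ofR x : K) = 0.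
Proof. by rewrite /imK /ofR; case: k. Qed.
Lemma reK_ofRM x z : reK (ofR x * z) = x * reK z.
Proof.
by move: z; rewrite /reK /ofR; case: k => //= -[a b] /=; rewrite mul0r subr0.
Qed.
Lemma K_decomp z : z = ofR (reK z) + jK * ofR (imK z).
Proof.
move: z; rewrite /reK /imK /jK /ofR; case: k => [x|[a b]].
  by rewrite mul0r addr0.
by apply/eqP; rewrite eq_complex /=; apply/andP; split; apply/eqP; ring.
Qed.
Lemma ge0_ofR z : 0 <= z -> z = ofR (reK z).
Proof.
move: z; rewrite /reK /ofR; case: k => [x//|[a b]] /=.
by rewrite lecE /= => /andP[/eqP -> _].
Qed.

Lemma normK z : `|z| = ofR (absR z).
Proof.
move: z; rewrite /absR /ofR; case: k => [x//|z].
by rewrite normc_def.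
Qed.
Lemma absR_le z w : (absR z <= absR w) = (`|z| <= `|w|).
Proof. by rewrite !normK ler_ofR. Qed.
Lemma absR_ofR x : absR (ofR x : K) = `|x|.
Proof.
rewrite /absR /ofR; case: k => //=.
by rewrite expr0n /= addr0 sqrtr_sqr.
Qed.
Lemma ofR_inj : injective (ofR : R -> K).
Proof. by move=> x y /(congr1 reK); rewrite !reK_ofR. Qed.
Lemma absR_ge0 z : 0 <= absR z.
Proof. by rewrite -(ler_ofR 0) ofR0 -normK. Qed.
Lemma absR0 : absR (0 : K) = 0.
Proof. by apply: ofR_inj; rewrite -normK normr0 ofR0. Qed.
Lemma absRM z w : absR (z * w) = absR z * absR w.
Proof. by apply: ofR_inj; rewrite ofRM -!normK normrM. Qed.
Lemma absRN z : absR (- z) = absR z.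
Proof. by apply: ofR_inj; rewrite -!normK normrN. Qed.
Lemma absRD z w : absR (z + w) <= absR z + absR w.
Proof. by rewrite -ler_ofR ofRD -!normK ler_normD. Qed.
Lemma absRC z w : absR (z - w) = absR (w - z).
Proof. by rewrite -absRN opprB. Qed.
Lemma absR_sum (I : Type) (r : seq I) (P : pred I) (F : I -> K) :
  absR (\sum_(i <- r | P i) F i) <= \sum_(i <- r | P i) absR (F i).
Proof.
by elim/big_rec2 : _ => [|i y1 y2 _ h]; rewrite ?absR0// (le_trans (absRD _ _))// lerD2l.
Qed.
Lemma absR_eq0 z : absR z = 0 -> z = 0.
Proof. by move=> h; apply/eqP; rewrite -normr_eq0 normK h ofR0. Qed.
Lemma absR_dist z w t : absR (z - t) <= absR (z - w) + absR (w - t).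
Proof. by rewrite (le_trans _ (absRD _ _))// addrA subrK. Qed.
Lemma absR_small z : (forall e, 0 < e -> absR z <= e) -> z = 0.
Proof.
move=> h; apply: absR_eq0; apply/eqP; rewrite eq_le absR_ge0 andbT.
by apply/ler_addgt0Pr => e e0; rewrite add0r h.
Qed.
Lemma reK_absR z : `|reK z| <= absR z.
Proof.
move: z; rewrite /reK /absR; case: k => //= -[a b] /=.
by rewrite -sqrtr_sqr ler_wsqrtr// lerDl sqr_ge0.
Qed.
Lemma imK_absR z : `|imK z| <= absR z.
Proof.
move: z; rewrite /imK /absR; case: k => /= [x|[a b] /=].
  by rewrite normr0.
by rewrite -sqrtr_sqr ler_wsqrtr// lerDr sqr_ge0.
Qed.
Lemma absR_jK : absR (jK : K) <= 1.
Proof.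
rewrite /absR /jK; case: k => /=; first by rewrite normr0.
by rewrite expr0n expr1n add0r sqrtr1.
Qed.
Lemma gt0_ofR z : 0 < z -> z = ofR (reK z) /\ 0 < reK z.
Proof.
move=> z0; have e := ge0_ofR (ltW z0); split => //.
by rewrite -(ltr_ofR) ofR0 -e.
Qed.

Lemma cvgK (T : Type) (F : set_system T) (FF : Filter F) (g : T -> K) (l : K) :
  g @ F --> l <-> forall e : R, 0 < e -> \forall t \near F, absR (g t - l) < e.
Proof.
split=> [/cvgrPdist_lt h e e0|h].
  have /h : 0 < (ofR e : K) by rewrite -ofR0 ltr_ofR.
  by apply: filterS => t; rewrite normK ltr_ofR absRC.
apply/cvgrPdist_lt => e /gt0_ofR[eE /h]; apply: filterS => t te.
by rewrite eE normK ltr_ofR absRC.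
Qed.

Lemma nbhsK (z : K) (U : set K) :
  nbhs z U <-> exists2 e : R, 0 < e & forall w, absR (w - z) < e -> U w.
Proof.
split=> [|[e e0 h]].
  move/nbhs_ballP => [e /gt0_ofR[eE e0] h]; exists (reK e) => // w wz.
  by apply: h; rewrite /ball /= eE normK ltr_ofR absRC.
apply/nbhs_ballP; exists (ofR e); first by rewrite /= -ofR0 ltr_ofR.
by move=> w; rewrite /ball /= normK ltr_ofR absRC; exact: h.
Qed.

(** The real and imaginary parts are Cauchy along the filter, hence converge. *)
Lemma K_complete (T : Type) (F : set_system T) (FF : ProperFilter F) (g : T -> K) :
  (forall e : R, 0 < e -> exists c, \forall t \near F, absR (g t - c) < e) ->
  exists l : K, g @ F --> l.
Proof.
move=> h.
have key (p : K -> R) : (forall z w, p (z - w) = p z - p w) ->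
    (forall z, `|p z| <= absR z) -> cvg ((p \o g) @ F).
  move=> pB pa; apply/cauchy_cvgP/cauchy_exP => e e0.
  have [c hc] := h _ e0; exists (p c) => /=.
  rewrite /fmap /=; near_simpl; apply: filterS hc => t tc.
  by rewrite /ball /= -pB (le_lt_trans (pa _))// absRC.
have /cvg_ex[a /cvgrPdist_lt ha] := key reK reKB reK_absR.
have /cvg_ex[b /cvgrPdist_lt hb] := key imK imKB imK_absR.
exists (ofR a + jK * ofR b); apply/cvgK => e e0.
have e2 : 0 < e / 2 by rewrite divr_gt0.
near=> t.
have -> : g t - (ofR a + jK * ofR b) =
    ofR (reK (g t) - a) + jK * ofR (imK (g t) - b).
  by rewrite {1}(K_decomp (g t)) !ofRB mulrBr opprD addrACA.
rewrite (le_lt_trans (absRD _ _))// absRM !absR_ofR (splitr e) ltrD//.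
  by rewrite distrC; near: t; exact: ha.
rewrite (@le_lt_trans _ _ `|imK (g t) - b|)//.
  by rewrite ler_piMl// absR_jK.
by rewrite distrC; near: t; exact: hb.
Unshelve. all: by end_near. Qed.

End scalar_theory.

(** * k-ification and spaces of maps *)

Lemma cvg_initial (I : Type) (S : choiceType) (T : topologicalType) (f : S -> T)
    (F : set_system I) (FF : Filter F) (u : I -> S) (s : S) :
  (f \o u) @ F --> f s -> u @ F --> (s : initial_topology f).
Proof.
move=> fu U; rewrite nbhsE => -[_ [[B oB <-] Bs] sU].
by apply: filterS sU _; apply: (fu B); exact: open_nbhs_nbhs.
Qed.

Section kify_lemmas.
Variable Y : topologicalType.

Lemma kify_continuous : continuous (id : kify Y -> Y).
Proof.
apply/continuousP => U oU.
suff : kopen U by [].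
by move=> Q p _ _ cp; move/continuousP : cp; exact.
Qed.

Lemma continuous_to_kify (Q : topologicalType) (p : Q -> Y) :
  compact [set: Q] -> hausdorff_space Q -> continuous p ->
  continuous (p : Q -> kify Y).
Proof. by move=> cQ hQ cp; apply/continuousP => U kU; exact: kU. Qed.

Lemma continuous_from_kify (Z : topologicalType) (f : Y -> Z) :
  (forall (Q : topologicalType) (p : Q -> Y),
     compact [set: Q] -> hausdorff_space Q -> continuous p ->
     continuous (f \o p)) ->
  continuous (f : kify Y -> Z).
Proof.
move=> h; apply/continuousP => U oU.
suff : kopen (f @^-1` U) by [].
move=> Q p cQ hQ cp.
by have /continuousP := h Q p cQ hQ cp; exact.
Qed.

(** Otherwise the filter of neighbourhoods of infinity, restricted to [C], would
    have no cluster point. *)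
Lemma compact_nat_bounded (C : set nat) : compact C ->
  \forall n \near \oo, ~ C n.
Proof.
move=> cC; apply: contrapT => nC.
pose F : set_system nat := within C \oo.
have FF : ProperFilter F.
  apply: Build_ProperFilter_ex => A; rewrite /F /within /= => hA.
  apply: contrapT => nA; apply: nC; apply: filterS hA => n h Cn.
  by apply: nA; exists n; exact: h.
have FC : F C by rewrite /F /within /=; exact: filterE.
have [c [_ cc]] := cC F FF FC.
have [n [/= [cn _] nc]] : ([set n | (c < n)%N /\ C n] `&` [set c]) !=set0.
  apply: cc; last exact: discrete_set1.
  rewrite /F /within /=; near=> n; move=> Cn; split => //; near: n.
  exact: nbhs_infty_gt.
by move: cn; rewrite nc ltnn.
Unshelve. all: by end_near. Qed.

(** A convergent sequence together with its limit is a continuous image of the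
    one-point compactification of [nat], so k-ification does not destroy its
    convergence. *)
Lemma kify_cvg_seq (u : nat -> Y) (l : Y) :
  u @ \oo --> l -> (u : nat -> kify Y) @ \oo --> (l : kify Y).
Proof.
move=> ul; pose p (o : one_point_compactification nat) : Y :=
  if o is Some n then u n else l.
have cp : continuous p.
  move=> [n|] U /= Uo.
    rewrite /nbhs /= /nbhs /=.
    by apply/principal_filterP => /=; exact: nbhs_singleton Uo.
  have [N _ hN] := ul _ Uo.
  exists [set n | (n < N)%N]; last first.
    move=> _ /= [[m mN <-]|->]; last exact: nbhs_singleton Uo.
    by apply: hN; rewrite /= leqNgt; apply/negP.
  split; last exact: discrete_closed.
  exact/finite_compact/finite_II.
have hQ : hausdorff_space (one_point_compactification nat).
  apply: one_point_compactification_hausdorff; last exact: discrete_hausdorff.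
  move=> x _; exists [set x]; last first.
    by split; [exact: compact_set1|exact: discrete_closed].
  rewrite /within /=; near=> y => _; near: y.
  exact: discrete_set1.
have ck := continuous_to_kify (@one_point_compactification_compact _) hQ cp.
move=> U Ul; have [C [cC _] CU] := ck None U Ul.
apply: filterS (compact_nat_bounded cC) => n nCn.
by apply: (CU (Some n)); left; exists n.
Unshelve. all: by end_near. Qed.

End kify_lemmas.

Section Cmaps_lemmas.
Variables X Y : topologicalType.

Lemma cptopen_open (Q : set X) (O : set Y) : compact Q -> open O ->
  open [set g : cptopen_maps X Y | cmap_fun g @` Q `<=` O].
Proof.
move=> cQ oO; exists [set g : {compact-open, X -> Y} | g @` Q `<=` O] => //.
exact: compact_open_open.
Qed.

Lemma Cmaps_open (Q : set X) (O : set Y) : compact Q -> open O ->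
  open [set g : Cmaps X Y | cmap_fun g @` Q `<=` O].
Proof.
move=> cQ oO; have /continuousP h := @kify_continuous (cptopen_maps X Y).
exact: (h _ (cptopen_open cQ oO)).
Qed.

Lemma cmap_cts (f : Cmaps X Y) : continuous (cmap_fun f).
Proof. exact: (@cts_fun _ _ (f : continuousType X Y)). Qed.

Lemma cptopen_cvg (I : Type) (F : set_system I) (FF : Filter F)
    (u : I -> cptopen_maps X Y) (f : cptopen_maps X Y) :
  (forall Q O, compact Q -> open O -> cmap_fun f @` Q `<=` O ->
     \forall n \near F, cmap_fun (u n) @` Q `<=` O) ->
  u @ F --> f.
Proof.
move=> h; apply: cvg_initial; apply/compact_open_cvgP => Q O cQ oO fO.
exact: h.
Qed.

Lemma Cmaps_cvg_seq (u : nat -> Cmaps X Y) (f : Cmaps X Y) :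
  (forall Q O, compact Q -> open O -> cmap_fun f @` Q `<=` O ->
     \forall n \near \oo, cmap_fun (u n) @` Q `<=` O) ->
  u @ \oo --> f.
Proof.
by move=> h; apply: (@kify_cvg_seq (cptopen_maps X Y)); exact: cptopen_cvg.
Qed.

Lemma eval_Cmaps_continuous x : continuous (fun g : Cmaps X Y => cmap_fun g x).
Proof.
apply/continuousP => O oO.
rewrite (_ : _ @^-1` _ = [set g : Cmaps X Y | cmap_fun g @` [set x] `<=` O]).
  by apply: Cmaps_open => //; exact: compact_set1.
by apply/seteqP; split => g /= h; [move=> _ [_ -> <-]|apply: h; exists x].
Qed.

End Cmaps_lemmas.

Section Cb_topology.
Variables (K : numFieldType) (X : topologicalType).

Lemma Cb_open_subbase (Q : set X) (O : set K) : compact Q -> open O ->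
  open [set f : Cb K X | f @` Q `<=` O].
Proof.
move=> cQ oO; suff : Cb_open [set f : Cb K X | f @` Q `<=` O] by [].
move=> n; rewrite (_ : _ @^-1` _ = [set g : disk_maps K X n |
    cmap_fun g @` Q `<=` set_val @^-1` O]).
  apply: Cmaps_open => //; apply: open_comp => // z _.
  exact: initial_continuous.
apply/seteqP; split => g /= h _ [x Qx <-].
  by apply: h; exists x.
by apply: (h (cmap_fun g x)); exists x.
Qed.

Lemma Cb_continuous_from (Z : topologicalType) (psi : Cb K X -> Z) :
  (forall n, continuous (fun g : disk_maps K X n => psi (Cb_incl g))) ->
  continuous psi.
Proof.
move=> h; apply/continuousP => U oU.
suff : Cb_open (psi @^-1` U) by [].
by move=> n; have /continuousP := h n; exact.
Qed.

Lemma Cb_incl_continuous n : continuous (@Cb_incl K X n).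
Proof. by apply/continuousP => U oU; exact: (oU n). Qed.

Lemma Cb_cts (f : Cb K X) : continuous f.
Proof. by case: f => f /= /bounded_continuousP[]. Qed.

Lemma Cb_eval_continuous x : continuous (fun f : Cb K X => f x).
Proof.
apply/continuousP => O oO.
rewrite (_ : _ @^-1` _ = [set f : Cb K X | f @` [set x] `<=` O]).
  by apply: Cb_open_subbase => //; exact: compact_set1.
by apply/seteqP; split => g /= h; [move=> _ [_ -> <-]|apply: h; exists x].
Qed.

End Cb_topology.


(** * Test functions *)

Section scalar_functionals.
Variables (F : numFieldType) (V : lmodType F) (psi : V -> F).
Hypothesis lin : scalar psi.

Lemma scalar_fun0 : psi 0 = 0.
Proof. by have := lin (-1) 0 0; rewrite scaler0 addr0 mulN1r addNr. Qed.
Lemma scalar_funD f g : psi (f + g) = psi f + psi g.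
Proof. by have := lin 1 f g; rewrite scale1r mul1r. Qed.
Lemma scalar_funZ a f : psi (a *: f) = a * psi f.
Proof. by have := lin a f 0; rewrite !addr0 scalar_fun0 addr0. Qed.
Lemma scalar_funN f : psi (- f) = - psi f.
Proof. by rewrite -scaleN1r scalar_funZ mulN1r. Qed.
Lemma scalar_funB f g : psi (f - g) = psi f - psi g.
Proof. by rewrite scalar_funD scalar_funN. Qed.
Lemma scalar_fun_sum (I : Type) (r : seq I) (P : pred I) (f : I -> V) :
  psi (\sum_(i <- r | P i) f i) = \sum_(i <- r | P i) psi (f i).
Proof. by elim/big_rec2 : _ => [|i y z _ <-]; rewrite ?scalar_fun0// scalar_funD. Qed.

End scalar_functionals.

Section test_functions.
Variables (R : realType) (k : scalar_kind) (X : topologicalType).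
Local Notation K := (scalars R k).

Lemma CbD (F : numFieldType) (f g : Cb F X) x : (f + g) x = f x + g x.
Proof. by []. Qed.
Lemma CbN (F : numFieldType) (f : Cb F X) x : (- f) x = - f x.
Proof. by []. Qed.
Lemma CbB (F : numFieldType) (f g : Cb F X) x : (f - g) x = f x - g x.
Proof. by []. Qed.
Lemma CbZ (F : numFieldType) a (f : Cb F X) x : (a *: f) x = a * f x.
Proof. by []. Qed.
Lemma Cb0 (F : numFieldType) x : (0 : Cb F X) x = 0.
Proof. by []. Qed.
Lemma Cb_oneE (F : numFieldType) x : Cb_one F X x = 1.
Proof. by []. Qed.
Lemma Cb_sum (F : numFieldType) (I : Type) (r : seq I) (P : pred I) (f : I -> Cb F X) x :
  (\sum_(i <- r | P i) f i) x = \sum_(i <- r | P i) f i x.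
Proof. by elim/big_rec2 : _ => [//|i y z _ <-]; rewrite CbD. Qed.
Lemma Cb_ext (F : numFieldType) (f g : Cb F X) : (forall x, f x = g x) -> f = g.
Proof. by move=> h; apply: val_inj; apply/funext. Qed.

Lemma Cb_bounded (f : Cb K X) : exists N : nat, forall x, absR (f x) <= N%:R.
Proof.
case: f => f /= /bounded_continuousP[_ [M fM]].
exists (Num.truncn (absR M)).+1 => x.
rewrite (@le_trans _ _ (absR M))//; last by rewrite ltW// truncnS_gt.
rewrite absR_le (le_trans (fM x))// real_ler_norm//.
exact: ger0_real (le_trans (normr_ge0 _) (fM x)).
Qed.

Lemma bounded_continuousK (f : X -> K) (M : R) :
  continuous f -> (forall x, absR (f x) <= M) -> f \in @bounded_continuous K X.
Proof.
move=> cf fM; apply/bounded_continuousP; split=> //.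
by exists (ofR M) => x; rewrite normK ler_ofR.
Qed.

Lemma bounded_continuousR (f : X -> R) (M : R) :
  continuous f -> (forall x, `|f x| <= M) -> f \in @bounded_continuous R X.
Proof. by move=> cf fM; apply/bounded_continuousP; split=> //; exists M. Qed.

Lemma CbR_bounded (f : Cb R X) : exists N : nat, forall x, `|f x| <= N%:R.
Proof.
case: f => f /= /bounded_continuousP[_ [M fM]].
exists (Num.truncn `|M|).+1 => x.
rewrite (@le_trans _ _ `|M|)//; last by rewrite ltW// truncnS_gt.
by rewrite (le_trans (fM x))// ler_norm.
Qed.

Fact ofCb_subproof (u : Cb R X) : (fun x => ofR (u x) : K) \in @bounded_continuous K X.
Proof.
have [N uN] := CbR_bounded u; apply: (@bounded_continuousK _ N%:R).
  move=> x; apply/cvgK => e e0.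
  have /cvgrPdist_lt/(_ e e0) := @Cb_cts _ _ u x.
  by apply: filterS => y; rewrite -ofRB absR_ofR distrC.
by move=> x; rewrite absR_ofR.
Qed.
Definition ofCb u : Cb K X := MkCb (ofCb_subproof u).

Lemma real_part_subproof (p : K -> R) (f : Cb K X) :
  (forall z w, p (z - w) = p z - p w) -> (forall z, `|p z| <= absR z) ->
  p \o f \in @bounded_continuous R X.
Proof.
move=> pB pa; have [N fN] := Cb_bounded f.
apply: (@bounded_continuousR _ N%:R); last by move=> x; rewrite (le_trans (pa _)).
move=> x; apply/cvgrPdist_lt => e e0.
have /cvgK/(_ e e0) := @Cb_cts _ _ f x.
by apply: filterS => y; apply: le_lt_trans; rewrite distrC -pB.
Qed.
Definition reCb (f : Cb K X) : Cb R X :=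
  MkCb (real_part_subproof f (@reKB R k) (@reK_absR R k)).
Definition imCb (f : Cb K X) : Cb R X :=
  MkCb (real_part_subproof f (@imKB R k) (@imK_absR R k)).

Lemma ofCbE u x : ofCb u x = ofR (u x). Proof. by []. Qed.
Lemma ofCbD u v : ofCb (u + v) = ofCb u + ofCb v.
Proof. by apply: Cb_ext => x; rewrite CbD !ofCbE -ofRD. Qed.
Lemma ofCbB u v : ofCb (u - v) = ofCb u - ofCb v.
Proof. by apply: Cb_ext => x; rewrite CbB !ofCbE -ofRB. Qed.
Lemma ofCbZ a u : ofCb (a *: u) = ofR a *: ofCb u.
Proof. by apply: Cb_ext => x; rewrite CbZ !ofCbE -ofRM. Qed.
Lemma ofCb_one : ofCb (Cb_one R X) = Cb_one K X.
Proof. by apply: Cb_ext => x; rewrite ofCbE /= ofR1. Qed.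
Lemma Cb_reim (f : Cb K X) : f = ofCb (reCb f) + jK *: ofCb (imCb f).
Proof. by apply: Cb_ext => x; rewrite CbD CbZ !ofCbE -K_decomp. Qed.

Fact mulCb_subproof (f : Cb K X) (u : Cb R X) :
  (fun x => f x * ofR (u x)) \in @bounded_continuous K X.
Proof.
have [N fN] := Cb_bounded f; have [M uM] := CbR_bounded u.
apply: (@bounded_continuousK _ (N%:R * M%:R)).
  by move=> x; apply: cvgM; [exact: Cb_cts|exact: (@Cb_cts _ _ (ofCb u))].
by move=> x; rewrite absRM absR_ofR ler_pM// absR_ge0.
Qed.
Definition mulCb f u : Cb K X := MkCb (mulCb_subproof f u).
Lemma mulCbE f u x : mulCb f u x = f x * ofR (u x). Proof. by []. Qed.

(** The topological content of countable additivity: the functional is small on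
    whatever is dominated by a late term of a sequence decreasing to 0. *)
Definition smooth (psi : Cb K X -> K) : Prop :=
  forall u : nat -> Cb R X,
    (forall n x, u n.+1 x <= u n x) ->
    (forall x e, 0 < e -> exists n, u n x < e) ->
    forall e, 0 < e ->
      exists n, forall f : Cb K X, (forall x, absR (f x) <= u n x) -> absR (psi f) <= e.

Lemma decreasing_le (u : nat -> Cb R X) : (forall n x, u n.+1 x <= u n x) ->
  forall m n x, (m <= n)%N -> u n x <= u m x.
Proof.
move=> udec m n x mn; rewrite -(subnK mn) addnC.
by elim: (n - m)%N => [|q IH]; rewrite ?addn0// addnS (le_trans (udec _ _)).
Qed.

(** The sets on which a term is at least [e] are closed and decreasing; by
    compactness they cannot all be nonempty. *)
Lemma dini (u : nat -> Cb R X) (Q : set X) (e : R) :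
  (forall n x, u n.+1 x <= u n x) -> (forall x, exists n, u n x < e) ->
  compact Q -> exists n, forall x, Q x -> u n x < e.
Proof.
move=> udec u0 cQ; apply: contrapT => /forallNP nh.
have dec := decreasing_le udec.
pose A n := [set x | Q x /\ e <= u n x].
have A0 n : A n !=set0.
  by have /existsNP[x /not_implyP[Qx /negP]] := nh n; rewrite -leNgt => h; exists x.
have FF : ProperFilter (filter_from setT A).
  apply: filter_from_proper; last by move=> n _; exact: A0.
  apply: filter_from_filter; first by exists 0%N.
  move=> m n _ _; exists (maxn m n) => // x [Qx h].
  by split; split => //; apply: (le_trans h); apply: dec; rewrite ?leq_maxl ?leq_maxr.
have [c [Qc cc]] := cQ _ FF (ex_intro2 _ _ 0%N I (fun x (h : A 0%N x) => h.1)).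
have [n uc] := u0 c.
have [y [[_ /=]]] : (A n `&` [set y | u n y < e]) !=set0.
  apply: cc; first by exists n.
  have /cvgr_lt : u n y @[y --> c] --> u n c by exact: Cb_cts.
  exact.
by rewrite leNgt => /negP.
Qed.

Lemma disk_representative (N : nat) (f : Cb K X) : (forall x, absR (f x) <= N%:R) ->
  exists g : disk_maps K X N, Cb_incl g = f.
Proof.
move=> fN.
have dN x : @disk K N (f x) by rewrite /disk /= normK -ofR_nat ler_ofR.
pose g0 (x : X) : set_type (@disk K N) := exist _ (f x) (mem_set (dN x)).
have cg : continuous g0 by move=> x; apply: cvg_initial; exact: Cb_cts.
by exists (mkcts cg : continuousType X _); exact: Cb_ext.
Qed.

(** A sequence dominated by functions decreasing to 0 tends to 0 uniformly on
    compact sets, hence in [Cb K X]; so continuity on the dual side already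
    entails smoothness. *)
Lemma natural_dual_smooth (phi : natural_dual (Cb K X)) :
  smooth (natural_dual_fun phi).
Proof.
move=> u udec u0 e e0; apply: contrapT => /forallNP nh.
have {nh} /choice[f fP] n : exists f : Cb K X, (forall x, absR (f x) <= u n x) /\
    e < absR (natural_dual_fun phi f).
  have /existsNP[f /not_implyP[h /negP]] := nh n; rewrite -ltNge => h'.
  by exists f.
have dec := decreasing_le udec.
have [N uN] := CbR_bounded (u 0%N).
have fN n x : absR (f n x) <= N%:R.
  rewrite (le_trans ((fP n).1 x))// (le_trans (dec 0%N n x _))//.
  by rewrite (le_trans (ler_norm _)).
have /choice[g gP] n := disk_representative (fN n).
have [g0 g0P] : exists g : disk_maps K X N, Cb_incl g = 0.
  by apply: disk_representative => x; rewrite Cb0 absR0.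
have gE n x : set_val (cmap_fun (g n) x) = f n x by rewrite -(gP n).
have g0E x : set_val (cmap_fun g0 x) = 0 by rewrite -(Cb0 _ x) -g0P.
have gcvg : g @ \oo --> g0.
  apply: Cmaps_cvg_seq => Q O cQ [W oW WO] gO.
  have [x0|Q0] := pselect (Q !=set0); last first.
    by apply: nearW => n y [x Qx _]; case: Q0; exists x.
  have [x Qx] := x0.
  have : W 0.
    rewrite -(g0E x).
    suff : (set_val @^-1` W) (cmap_fun g0 x) by [].
    by rewrite WO; apply: gO; exists x.
  move=> W0; have [r r0 hr] : exists2 r : R, 0 < r & forall w : K, absR (w - 0) < r -> W w.
    by apply/nbhsK; exact: open_nbhs_nbhs.
  have [n0 hn0] := dini udec (fun x => u0 x r r0) cQ.
  exists n0 => // n /= n0n _ [y Qy <-]; rewrite -WO /=; apply: hr.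
  rewrite subr0 gE (le_lt_trans ((fP n).1 y))// (le_lt_trans (dec n0 n y n0n))//.
  exact: hn0.
have phic : continuous (natural_dual_fun phi) by exact: cmap_cts.
have : natural_dual_fun phi (Cb_incl (g n)) @[n --> \oo] --> natural_dual_fun phi (Cb_incl g0).
  apply: (@cvg_comp _ _ _ (fun n => Cb_incl (g n)) (natural_dual_fun phi)); last exact: phic.
  apply: (@cvg_comp _ _ _ g (@Cb_incl K X N)); first exact: gcvg.
  exact: Cb_incl_continuous.
move=> /cvgK/(_ e e0)[n _ /(_ n (leqnn n))] /=.
have -> : natural_dual_fun phi (Cb_incl g0) = 0.
  by rewrite g0P; exact: scalar_fun0 (set_valP phi).
by rewrite subr0 gP ltNge (ltW (fP n).2).
Qed.

End test_functions.


(** * Polish spaces *)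

(** A complete metric on [X] itself and a dense sequence; the sequence takes
    values in [option X] so that the empty space needs no separate treatment. *)
Record polish_data (R : realType) (X : topologicalType) := PolishData {
  dist : X -> X -> R;
  dist_xx : forall x, dist x x = 0;
  dist_sym : forall x y, dist x y = dist y x;
  dist_triangle : forall y x z, dist x z <= dist x y + dist y z;
  nbhs_dist : forall x (U : set X),
    nbhs x U <-> exists2 e, 0 < e & forall y, dist x y < e -> U y;
  dist_complete : forall F : set_system X, ProperFilter F ->
    (forall e, 0 < e -> exists x, F [set y | dist x y < e]) ->
    exists l : X, F --> l;
  dense_seq : nat -> option X;
  dense_seqP : forall x e, 0 < e ->
    exists n y, dense_seq n = Some y /\ dist x y < e }.

Lemma polish_dataP (R : realType) (X : topologicalType) :
  polish R X -> exists _ : polish_data R X, True.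
Proof.
move=> [[C cC dC] [M [h [g [hK gK ch cg complM]]]]].
pose d (x y : X) : R := mdist (h x) (h y).
have dnbhs x (U : set X) :
    nbhs x U <-> exists2 e, 0 < e & forall y, d x y < e -> U y.
  split=> [xU|[e e0 eU]].
    have : nbhs (h x) (g @^-1` U) by apply: cg; rewrite hK.
    move=> /nbhs_ballP[e /= e0 eU]; exists e => // y dxy.
    by have := eU (h y); rewrite ballEmdist /= hK; exact.
  have hU : nbhs (h x) [set y | mdist (h x) y < e].
    by rewrite -ballEmdist; exact: nbhsx_ballx.
  have hx : nbhs x (h @^-1` [set y | mdist (h x) y < e]) := ch x _ hU.
  by apply: (filterS _ hx) => y; exact: eU.
have [s sP] : exists s : nat -> option X, forall x, C x -> exists n, s n = Some x.
  have [f finj] : exists f : X -> nat, {in C &, injective f}.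
    by move/countable_injP : cC.
  exists (fun n => if pselect (exists2 x, C x & f x = n) is left H
    then Some (projT1 (cid2 H)) else None) => x Cx; exists (f x).
  case: pselect => [H|[]]; last by exists x.
  case: (cid2 H) => y Cy /= fxy; congr Some.
  by apply: finj; rewrite ?inE.
unshelve eexists; last by [].
apply: (@PolishData R X d _ _ _ dnbhs _ s).
- by move=> x; exact: mdistxx.
- by move=> x y; exact: metric_sym.
- by move=> y x z; exact: metric_triangle.
- move=> F FF hF.
  have [l hl] : exists l : M, h @ F --> l.
    apply: complM; apply/cauchy_exP => e e0.
    have [x Fx] := hF e e0; exists (h x).
    by rewrite ballEmdist.
  exists (g l); have := continuous_cvg _ (cg l) hl => /(_ _).
  by rewrite (_ : g \o h = id); [exact|apply/funext => x /=; rewrite hK].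
- move=> x e e0.
  have [y [/= dxy Cy]] : [set y | d x y < e]° `&` C !=set0.
    apply: dC; last exact: open_interior.
    exists x; apply/dnbhs; exists e => //.
  have [n sn] := sP _ Cy; exists n, y; split => //.
  exact: (interior_subset dxy).
Qed.

Section metric_continuity.
Variables (R : realType) (k : scalar_kind) (X : topologicalType).
Variable P : polish_data R X.
Local Notation K := (scalars R k).
Local Notation d := (dist P).

Lemma dist_ge0 x y : 0 <= d x y.
Proof.
rewrite -(@pmulrn_lge0 _ _ 2)// -(dist_xx P x) mulr2n.
by rewrite {2}(dist_sym P x y) (dist_triangle P y).
Qed.

Lemma near_dist x e : 0 < e -> \forall y \near x, d x y < e.
Proof. by move=> e0; apply/(nbhs_dist P); exists e. Qed.

Lemma cvg_distP (I : Type) (F : set_system I) (FF : Filter F) (u : I -> X) x :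
  (forall e, 0 < e -> \forall i \near F, d x (u i) < e) -> u @ F --> x.
Proof.
by move=> h U /(nbhs_dist P)[e /h he eU]; apply: filterS he => i; exact: eU.
Qed.

Lemma lipschitz_continuous (u : X -> R) (C : R) :
  (forall x y, `|u x - u y| <= C * d x y) -> continuous u.
Proof.
move=> uC x; apply/cvgrPdist_lt => e e0.
have C1 : 0 < `|C| + 1 by rewrite ltr_wpDl.
near=> y; rewrite (le_lt_trans (uC x y))//.
rewrite (@le_lt_trans _ _ ((`|C| + 1) * d x y))//.
  by rewrite ler_wpM2r ?dist_ge0// (le_trans (ler_norm _))// lerDl.
rewrite mulrC -ltr_pdivlMr//.
by near: y; apply: near_dist; rewrite divr_gt0.
Unshelve. all: by end_near. Qed.

(** In an unbounded set choose an [n]-th function of sup norm above [n]. The tails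
    of this sequence meet each disk in finitely many points, so they are closed
    for the colimit topology, and their intersection is empty. *)
Lemma compact_Cb_bounded (L : set (Cb K X)) : compact L ->
  exists N : nat, forall f, L f -> forall x, absR (f x) <= N%:R.
Proof.
move=> cL; apply: contrapT => nb.
have /choice[f fP] (n : nat) : exists f : Cb K X, L f /\ exists x, n%:R < absR (f x).
  apply: contrapT => nf; apply: nb; exists n => f Lf x; rewrite leNgt.
  by apply/negP => h; apply: nf; exists f; split => //; exists x.
have cl1 (h : Cb K X) : closed [set h].
  rewrite (_ : [set h] = \bigcap_x [set g : Cb K X | g x = h x]).
    apply: closed_bigI => x _; apply: (@preimage_closed _ _ (fun g : Cb K X => g x) [set h x]).
      by move=> g _; exact: Cb_eval_continuous.
    exact/accessible_closed_set1/hausdorff_accessible/norm_hausdorff.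
  apply/seteqP; split => [g /= -> //|g gh]; apply: Cb_ext => x; exact: gh.
pose A n := [set f m | m in [set m | (n <= m)%N]].
have clA n : closed (A n).
  rewrite -openC; suff : Cb_open (~` A n) by [].
  move=> N; rewrite preimage_setC openC.
  have E : @Cb_incl K X N @^-1` A n =
      @Cb_incl K X N @^-1` (\bigcup_(m in [set m | (n <= m < N)%N]) [set f m]).
    apply/seteqP; split => g [m /=].
      move=> nm fm; exists m => //=; rewrite nm ltnNge; apply/negP => Nm.
      have [_ [x]] := fP m; rewrite fm ltNge => /negP; apply.
      rewrite (@le_trans _ _ N%:R) ?ler_nat// -(ler_ofR k) -normK ofR_nat.
      exact: (set_valP (cmap_fun g x)).
    by move=> /andP[nm _] gm; exists m.
  suff : closed (@Cb_incl K X N @^-1` A n) by [].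
  rewrite E; apply: preimage_closed; first by move=> g _; exact: Cb_incl_continuous.
  apply: closed_bigcup => //.
  by apply: (sub_finite_set _ (finite_II N)) => m /= /andP[].
have Ff n : (f @ \oo) (A n) by exists n => // m /= nm; exists m.
have FL : (f @ \oo) L by exists 0%N => // n _; exact: (fP n).1.
have [g [_ gF]] := cL _ _ FL.
have gA n : A n g.
  rewrite [A n](closure_id (A n)).1//.
  by move=> B gB; exact: gF.
have [N gN] := Cb_bounded g.
have [m /= Nm fm] := gA N; have [_ [x]] := fP m.
by rewrite fm ltNge (le_trans (gN x))// ler_nat.
Qed.

Lemma compact_cvg_seq (y : nat -> X) (x : X) (n0 : nat) : y @ \oo --> x ->
  compact (x |` [set y n | n in [set n | (n0 <= n)%N]]).
Proof.
move=> yx; rewrite compact_ultra => F FU FQ.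
have [Fx|/existsNP[U /not_implyP[xU nFU]]] := pselect (F --> x).
  by exists x; split => //; left.
have [N _ hN] := yx _ xU.
have FV : F ((x |` [set y n | n in [set n | (n0 <= n)%N]]) `&` ~` U).
  by have [//|FnU] := in_ultra_setVsetC U FU; exact: filterI.
have : compact ((x |` [set y n | n in [set n | (n0 <= n)%N]]) `&` ~` U).
  apply/finite_compact; apply: (sub_finite_set _ (finite_image y (finite_II N))).
  move=> z [[->|[n /= n0n <-]] nU]; first by case: nU; exact: nbhs_singleton.
  by exists n => //=; rewrite ltnNge; apply/negP => Nn; apply: nU; exact: hN.
rewrite compact_ultra => /(_ F FU FV)[z [[Qz _] Fz]].
by exists z.
Qed.

Definition equicts (L : set (Cb K X)) := forall x e, 0 < e ->
  exists2 r, 0 < r & forall f y, L f -> d x y < r -> absR (f x - f y) < e.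

Lemma dist_lipschitz y a b : `|d a y - d b y| <= d a b.
Proof.
have := dist_triangle P b a y; have := dist_triangle P a b y.
by rewrite (dist_sym P b a) ler_norml => *; apply/andP; split; lra.
Qed.

Lemma closed_dist_le y e : closed [set x | d x y <= e].
Proof.
have dc : continuous (fun x => d x y).
  by apply: (@lipschitz_continuous _ 1) => a b; rewrite mul1r dist_lipschitz.
exact: closed_comp (fun x _ => dc x) (@closed_le _ e).
Qed.

(** If equicontinuity fails along a sequence [y n] tending to [x], a cluster point
    of the corresponding functions contradicts it, because the topology controls
    them uniformly on the compact set formed by [x] and the tail of [y]. *)
Lemma compact_Cb_equicts (L : set (Cb K X)) : compact L -> equicts L.
Proof.
move=> cL x e e0; apply: contrapT => nh.
have e3 : 0 < e / 3 by rewrite divr_gt0.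
have inv0 n : (0 : R) < n.+1%:R^-1 by rewrite invr_gt0.
have /choice[fy fyP] (n : nat) : exists fy : Cb K X * X,
    [/\ L fy.1, d x fy.2 < n.+1%:R^-1 & e <= absR (fy.1 x - fy.1 fy.2)].
  apply: contrapT => nf; apply: nh; exists n.+1%:R^-1 => // f y Lf dy.
  rewrite ltNge; apply/negP => h; apply: nf; by exists (f, y).
pose y n := (fy n).2; pose f n := (fy n).1.
pose F := f @ \oo.
have [g [Lg gF]] := cL F _ (filterE _ (fun n => let: And3 h _ _ := fyP n in h)).
have yx : y @ \oo --> x.
  apply: cvg_distP => r r0; near=> n; have [_ h _] := fyP n.
  rewrite (lt_trans h)//; near: n.
  exact: (near_infty_natSinv_lt (PosNum r0)).
have [n0 _ hn0] : \forall n \near \oo, absR (g (y n) - g x) < e / 3.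
  have /cvgK : g (y n) @[n --> \oo] --> g x by apply: (continuous_cvg _ (@Cb_cts _ _ g x) yx).
  exact.
pose Q := x |` [set y n | n in [set n | (n0 <= n)%N]].
have cQ : compact Q by exact: compact_cvg_seq.
pose W := [set z : K | absR (z - g x) < e / 3].
have oW : open W.
  rewrite openE => z zW; apply/nbhsK; exists (e / 3 - absR (z - g x)).
    by rewrite subr_gt0.
  move=> w; rewrite ltrBrDr => /(le_lt_trans _); apply.
  exact: absR_dist.
have : [set h : Cb K X | h @` Q `<=` W] g.
  by move=> _ [z [->|[n /= n0n <-]] <-]; rewrite /W /= ?subrr ?absR0//; exact: hn0.
move=> gQ; have := gF [set f n | n in [set n | (n0 <= n)%N]] [set h : Cb K X | h @` Q `<=` W].
case.
- by exists n0 => // n /= n0n; exists n.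
- by apply: open_nbhs_nbhs; split => //; exact: Cb_open_subbase.
move=> _ [[n n0n <-] /= fnQ]; have [_ _] := fyP n; apply/negP; rewrite -ltNge.
have := fnQ (f n x) (ex_intro2 _ _ x (or_introl erefl) erefl).
have := fnQ (f n (y n)) (ex_intro2 _ _ (y n) (or_intror (ex_intro2 _ _ n n0n erefl)) erefl).
rewrite /W /= => h1 h2.
rewrite -/(f n) -/(y n) (le_lt_trans (absR_dist _ (g x) _))// (absRC (g x)).
by move: h1 h2 e3; lra.
Unshelve. all: by end_near. Qed.

End metric_continuity.


(** * Approximation by Dirac functionals *)

Section partition_of_unity.
Variables (R : realType) (X : topologicalType) (P : polish_data R X).
Local Notation d := (dist P).
Implicit Types (r : R) (s : seq X) (x y : X).

Definition bump r y x : R := Num.max 0 (2 * r - d x y).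
Definition bumps r s x : R := \sum_(y <- s) bump r y x.

Lemma bump_ge0 r y x : 0 <= bump r y x.
Proof. by rewrite /bump le_max lexx. Qed.

Lemma bumps_ge0 r s x : 0 <= bumps r s x.
Proof. by apply: sumr_ge0 => y _; exact: bump_ge0. Qed.

Lemma maxr_lipschitz (a b c : R) : `|Num.max a c - Num.max b c| <= `|a - b|.
Proof.
have ab := ler_norm (a - b); have ba := ler_norm (b - a).
move: ba; rewrite distrC => ba; rewrite ler_norml.
by case: (leP a c) => ?; case: (leP b c) => ?; apply/andP; split; lra.
Qed.

Lemma bump_lipschitz r y a b : `|bump r y a - bump r y b| <= d a b.
Proof.
rewrite /bump maxC [Num.max _ (_ - d b y)]maxC (le_trans (maxr_lipschitz _ _ _))//.
have -> : 2 * r - d a y - (2 * r - d b y) = d b y - d a y by ring.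
by rewrite distrC dist_lipschitz.
Qed.

Lemma bumps_lipschitz r s a b : `|bumps r s a - bumps r s b| <= (size s)%:R * d a b.
Proof.
rewrite /bumps -sumrB (le_trans (ler_norm_sum _ _ _))//.
rewrite (le_trans (ler_sum _ (fun y _ => bump_lipschitz r y a b)))//.
by rewrite big_const_seq count_predT iter_addr_0 mulr_natl.
Qed.

(* The denominator exceeds the sum of the bumps only far from [s]; being at
   least [r] it keeps the quotients continuous. *)
Definition part_den r s x := Num.max (bumps r s x) r.

Lemma part_den_gt0 r s x : 0 < r -> 0 < part_den r s x.
Proof. by move=> r0; rewrite /part_den lt_max r0 orbT. Qed.

(* The test on [r] spares [part] a proof of positivity among its arguments. *)
Lemma part_subproof r s y : 
  (fun x => if 0 < r then bump r y x / part_den r s x else 0)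
    \in @bounded_continuous R X.
Proof.
have [r0|r0] := ltP 0 r; last first.
  apply: (@bounded_continuousR _ _ _ 0); first by move=> x; exact: cvg_cst.
  by move=> x; rewrite normr0.
apply: (@bounded_continuousR _ _ _ 2).
  move=> x; apply: cvgM.
    apply: (@lipschitz_continuous _ _ P _ 1) => a b.
    by rewrite mul1r bump_lipschitz.
  apply: cvgV; first by rewrite gt_eqF// part_den_gt0.
  apply: (@lipschitz_continuous _ _ P _ (size s)%:R) => a b.
  by rewrite /part_den (le_trans (maxr_lipschitz _ _ _))// bumps_lipschitz.
move=> x; rewrite ger0_norm ?divr_ge0 ?bump_ge0//; last exact/ltW/part_den_gt0.
rewrite ler_pdivrMr ?part_den_gt0// (@le_trans _ _ (2 * r))//.
  by rewrite /bump ge_max gerBl dist_ge0 andbT mulr_ge0// ltW.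
by rewrite ler_wpM2l// /part_den le_max lexx orbT.
Qed.

Definition part r s y : Cb R X := MkCb (part_subproof r s y).

(** The part of the constant 1 left over by the tents; it vanishes within distance
    [r] of [s]. *)
Definition rest r s : Cb R X := Cb_one R X - \sum_(y <- s) part r s y.

Lemma restE r s x : 0 < r -> rest r s x = 1 - bumps r s x / part_den r s x.
Proof.
move=> r0; rewrite /rest CbB Cb_sum /= mulr_suml.
by under eq_bigr do rewrite r0.
Qed.

Lemma part_ge0 r s y x : 0 <= part r s y x.
Proof.
rewrite /part /=; case: ifPn => // r0.
by rewrite divr_ge0// ?bump_ge0// ltW// part_den_gt0.
Qed.

Lemma rest_ge0 r s x : 0 < r -> 0 <= rest r s x.
Proof.
move=> r0; rewrite restE// subr_ge0 ler_pdivrMr ?part_den_gt0// mul1r.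
by rewrite /part_den le_max lexx.
Qed.

Lemma sum_part r s x : \sum_(y <- s) part r s y x = 1 - rest r s x.
Proof. by rewrite /rest CbB Cb_sum /= subKr. Qed.

Lemma part_far r s y x : 2 * r <= d x y -> part r s y x = 0.
Proof.
move=> h; rewrite /part /=; case: ifPn => // r0.
by rewrite /bump max_l ?mul0r// subr_le0.
Qed.

Lemma rest_near r s x y : 0 < r -> y \in s -> d x y < r -> rest r s x = 0.
Proof.
move=> r0 ys dxy; rewrite restE//.
have rb : r <= bumps r s x.
  rewrite /bumps (big_rem y)//= ler_wpDr//.
    by apply: sumr_ge0 => z _; exact: bump_ge0.
  by rewrite /bump le_max; apply/orP; right; lra.
by rewrite /part_den max_l// divff ?subrr// gt_eqF// (lt_le_trans r0).
Qed.

Lemma rest_cat r s t x : 0 < r -> rest r (s ++ t) x <= rest r s x.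
Proof.
move=> r0; rewrite !restE// lerD2l lerN2.
have bb : bumps r s x <= bumps r (s ++ t) x.
  by rewrite /bumps big_cat /= lerDl; apply: sumr_ge0 => y _; exact: bump_ge0.
rewrite ler_pdivrMr ?part_den_gt0// mulrAC ler_pdivlMr ?part_den_gt0//.
have := bumps_ge0 r s x; rewrite /part_den.
by case: (leP (bumps r s x)) => h1; case: (leP (bumps r (s ++ t) x)) => h2 h3; nra.
Qed.

Definition first_points (N : nat) : seq X := pmap (dense_seq P) (iota 0 N).

Lemma first_pointsS N : exists t, first_points N.+1 = first_points N ++ t.
Proof. by rewrite /first_points -addn1 iotaD pmap_cat; eexists. Qed.

Lemma first_points_dense x e : 0 < e ->
  exists N, forall M, (N <= M)%N -> exists2 y, y \in first_points M & d x y < e.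
Proof.
move=> e0; have [n [y [ny dxy]]] := dense_seqP P x e0.
exists n.+1 => M nM; exists y => //.
rewrite mem_pmap; apply/mapP; exists n => //.
by rewrite mem_iota add0n.
Qed.

Lemma rest_decr r N x : 0 < r ->
  rest r (first_points N.+1) x <= rest r (first_points N) x.
Proof. by move=> r0; have [t ->] := first_pointsS N; exact: rest_cat. Qed.

Lemma rest_eventually0 r x : 0 < r ->
  exists N, rest r (first_points N) x = 0.
Proof.
move=> r0; have [N /(_ N (leqnn _))[y ys dxy]] := first_points_dense x r0.
by exists N; exact: rest_near dxy.
Qed.

End partition_of_unity.

Section envelope.
Variables (R : realType) (k : scalar_kind) (X : topologicalType).
Variable P : polish_data R X.
Local Notation K := (scalars R k).
Local Notation d := (dist P).

(** Equal to 1 for [t <= 2 * r] and to 0 for [3 * r <= t], with slope at most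
    [r^-1]. *)
Definition cutoff (r t : R) : R := Num.max 0 (Num.min 1 (3 - t / r)).

Lemma cutoff01 r t : 0 <= cutoff r t <= 1.
Proof.
rewrite /cutoff le_max lexx /= ge_max ler01 /= ge_min lexx //.
Qed.

Lemma cutoff_lip r t t' : 0 < r -> `|cutoff r t - cutoff r t'| <= r^-1 * `|t - t'|.
Proof.
move=> r0; have r0' : 0 < r^-1 by rewrite invr_gt0.
have -> : r^-1 * `|t - t'| = `|t / r - t' / r|.
  by rewrite -mulrBl normrM (gtr0_norm r0') mulrC.
rewrite /cutoff; move: (t / r) (t' / r) => a b.
have ab := ler_norm (a - b); have ba := ler_norm (b - a).
move: ba; rewrite distrC => ba; rewrite ler_norml.
case: (leP 1 (3 - a)) => ?; case: (leP 1 (3 - b)) => ?;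
rewrite ?(max_r ler01);
repeat match goal with |- context [Num.max ?x ?y] => case: (leP x y) => ? end;
by apply/andP; split; lra.
Qed.

(** A continuous majorant of the oscillation over balls of radius [2 * r] of an
    equicontinuous family; a supremum cut off by a function of the distance is
    used because the oscillation itself is only semicontinuous. *)
Definition envelope_set (L : set (Cb K X)) r x : set R :=
  [set v | v = 0 \/ exists f y, L f /\ v = absR (f x - f y) * cutoff r (d x y)].

Definition envelope L r x : R := sup (envelope_set L r x).

Section bounded_equicts.
Variables (L : set (Cb K X)) (M : nat).
Hypothesis LM : forall f, L f -> forall x, absR (f x) <= M%:R.
Hypothesis LE : equicts P L.

Lemma envelope_has_sup r x : has_sup (envelope_set L r x).
Proof.
split; first by exists 0; left.
exists (2 * M%:R) => _ [->|[f [y [Lf ->]]]]; first by rewrite mulr_ge0.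
have /andP[c0 c1] := cutoff01 r (d x y).
have h : absR (f x - f y) <= 2 * M%:R.
  by rewrite (le_trans (absRD _ _))// absRN mulr2n mulrDl mul1r lerD// LM.
by rewrite -[leRHS]mulr1 ler_pM// absR_ge0.
Qed.

Lemma envelope_ub r x f y : L f ->
  absR (f x - f y) * cutoff r (d x y) <= envelope L r x.
Proof.
move=> Lf; apply: sup_upper_bound; first exact: envelope_has_sup.
by right; exists f, y.
Qed.

Lemma envelope_ge0 r x : 0 <= envelope L r x.
Proof. by apply: sup_upper_bound; [exact: envelope_has_sup|left]. Qed.

Lemma envelope_le r x v : 0 <= v ->
  (forall f y, L f -> absR (f x - f y) * cutoff r (d x y) <= v) ->
  envelope L r x <= v.
Proof.
move=> v0 h; apply: ge_sup; first exact: (envelope_has_sup r x).1.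
by move=> _ [->//|[f [y [Lf ->]]]]; exact: h.
Qed.

Lemma envelope_continuous r : 0 < r -> continuous (envelope L r).
Proof.
move=> r0 x; apply/cvgrPdist_le => e e0.
have e2 : 0 < e / 2 by rewrite divr_gt0.
have [q q0 hq] := LE x e2.
have C0 : 0 < 2 * M%:R * r^-1 + 1.
  by apply: ltr_wpDl => //; rewrite !mulr_ge0// invr_ge0 ltW.
have near_bound y f z : L f -> d x y < q -> d x y < e / 2 / (2 * M%:R * r^-1 + 1) ->
    `|absR (f x - f z) * cutoff r (d x z) - absR (f y - f z) * cutoff r (d y z)| <= e.
  move=> Lf dq de; set c := cutoff r _; set c' := cutoff r _.
  set a := absR _; set b := absR (f y - f z).
  have /andP[c0 c1] : 0 <= c <= 1 by exact: cutoff01.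
  have ab : `|a - b| <= e / 2.
    have fxy : absR (f x - f y) < e / 2 by exact: hq.
    have h1 := absR_dist (f x) (f y) (f z); have h2 := absR_dist (f y) (f x) (f z).
    by move: h1 h2; rewrite (absRC (f y) (f x)) -/a -/b ler_norml => *; apply/andP; split; lra.
  have b0 : 0 <= b by exact: absR_ge0.
  have bM : b <= 2 * M%:R.
    by rewrite (le_trans (absRD _ _))// absRN mulr2n mulrDl mul1r lerD// LM.
  have cc : `|c - c'| <= r^-1 * d x y.
    rewrite (le_trans (cutoff_lip _ _ r0))// ler_wpM2l//; first by rewrite invr_ge0 ltW.
    rewrite ler_norml.
    have h1 := dist_triangle P y x z; have h2 := dist_triangle P x y z.
    by move: h2; rewrite (dist_sym P y x) => h2; apply/andP; split; lra.
  have -> : a * c - b * c' = (a - b) * c + b * (c - c') by ring.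
  rewrite (le_trans (ler_normD _ _))// (splitr e) lerD//.
    by rewrite normrM (ger0_norm c0) -[leRHS]mulr1 ler_pM.
  rewrite normrM (ger0_norm b0) (le_trans (ler_pM _ _ bM cc))//.
  rewrite mulrA; move: de; rewrite ltr_pdivlMr// => /ltW; apply: le_trans.
  by rewrite mulrC ler_wpM2l ?dist_ge0// lerDl.
near=> y.
have dq : d x y < q by near: y; exact: near_dist.
have de : d x y < e / 2 / (2 * M%:R * r^-1 + 1).
  by near: y; apply: near_dist; rewrite divr_gt0.
rewrite ler_norml; apply/andP; split.
  rewrite lerBrDr addrC lerBlDr; apply: envelope_le => [|f z Lf].
    by rewrite addr_ge0 ?envelope_ge0// ltW.
  have := near_bound y f z Lf dq de; have := envelope_ub r x z Lf.
  by rewrite ler_norml => h /andP[h1 h2]; lra.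
rewrite lerBlDr; apply: envelope_le => [|f z Lf].
  by rewrite addr_ge0 ?envelope_ge0// ltW.
have := near_bound y f z Lf dq de; have := envelope_ub r y z Lf.
by rewrite ler_norml => h /andP[h1 h2]; lra.
Unshelve. all: by end_near. Qed.

Lemma envelope_le2M r x : envelope L r x <= 2 * M%:R.
Proof.
apply: envelope_le => [|f y Lf]; first by rewrite mulr_ge0.
have /andP[c0 c1] := cutoff01 r (d x y).
have h : absR (f x - f y) <= 2 * M%:R.
  by rewrite (le_trans (absRD _ _))// absRN mulr2n mulrDl mul1r lerD// LM.
by rewrite -[leRHS]mulr1 ler_pM// absR_ge0.
Qed.

Lemma oscillation_envelope : exists V : nat -> Cb R X,
  [/\ forall n x, V n.+1 x <= V n x,
      forall x e, 0 < e -> exists n, V n x < e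
    & forall n f x y, L f -> d x y < 2 / n.+1%:R -> absR (f x - f y) <= V n x].
Proof.
have inv0 n : (0 : R) < n.+1%:R^-1 by rewrite invr_gt0.
have bc n : envelope L n.+1%:R^-1 \in @bounded_continuous R X.
  apply: (@bounded_continuousR _ _ _ (2 * M%:R)); first exact: envelope_continuous.
  by move=> x; rewrite ger0_norm ?envelope_ge0// envelope_le2M.
exists (fun n => MkCb (bc n)); split=> /=.
- move=> n x; apply: envelope_le => [|f y Lf]; first exact: envelope_ge0.
  rewrite (le_trans _ (envelope_ub n.+1%:R^-1 x y Lf))// ler_wpM2l ?absR_ge0// /cutoff.
  rewrite !invrK; have := dist_ge0 P x y; set t := d x y => t0.
  have tt : t * n.+1%:R <= t * n.+2%:R by rewrite ler_wpM2l// ler_nat.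
  rewrite ge_max le_max lexx /= le_max; apply/orP; right.
  by rewrite le_min !ge_min lexx /=; apply/orP; right; lra.
- move=> x e e0; have e2 : 0 < e / 2 by rewrite divr_gt0.
  have [q q0 hq] := LE x e2.
  have [n hn] : exists n, 3 * n.+1%:R^-1 < q.
    have [n _ /(_ n (leqnn n))] := near_infty_natSinv_lt (PosNum (divr_gt0 q0 (ltr0n R 3))).
    by rewrite /= ltr_pdivlMr// mulrC => h; exists n.
  exists n; rewrite (@le_lt_trans _ _ (e / 2))//; last by lra.
  apply: envelope_le => [|f y Lf]; first exact: ltW.
  have /andP[c0 c1] := cutoff01 n.+1%:R^-1 (d x y).
  have [dq|qd] := ltP (d x y) q.
    by rewrite -[leRHS]mulr1 ler_pM// ?absR_ge0// ltW// hq.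
  rewrite (_ : cutoff _ _ = 0) ?mulr0 ?ltW//.
  rewrite /cutoff max_l// ge_min; apply/orP; right.
  by rewrite subr_le0 ler_pdivlMr// ltW// (lt_le_trans hn).
- move=> n f x y Lf dxy; rewrite (le_trans _ (envelope_ub n.+1%:R^-1 x y Lf))//.
  rewrite (_ : cutoff _ _ = 1) ?mulr1// /cutoff.
  rewrite min_l ?max_r//.
  have : d x y / n.+1%:R^-1 < 2 by rewrite ltr_pdivrMr.
  lra.
Qed.

End bounded_equicts.
End envelope.

Section dirac_approximation.
Variables (R : realType) (k : scalar_kind) (X : topologicalType).
Variable P : polish_data R X.
Local Notation K := (scalars R k).
Local Notation d := (dist P).

Section one_functional.
Variable psi : Cb K X -> K.
Hypothesis lin : scalar psi.

Definition dirac_sum (r : R) (s : seq X) (f : Cb K X) : K :=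
  \sum_(y <- s) psi (ofCb k (part P r s y)) * f y.

Definition osc_part (r : R) (s : seq X) (f : Cb K X) : Cb K X :=
  \sum_(y <- s) mulCb (f - f y *: Cb_one K X) (part P r s y).

(** Split [f] along the partition of unity and freeze it at the centre of each
    tent. *)
Lemma dirac_sumE r s f :
  psi f - dirac_sum r s f = psi (mulCb f (rest P r s)) + psi (osc_part r s f).
Proof.
have fE : f = mulCb f (rest P r s) + (osc_part r s f +
    \sum_(y <- s) f y *: ofCb k (part P r s y)).
  apply: Cb_ext => x; rewrite !CbD /osc_part !Cb_sum -big_split.
  rewrite (eq_bigr (fun y => f x * ofR (part P r s y x))) => [|y _]; last first.
    rewrite mulCbE CbB !CbZ Cb_oneE ofCbE; set p := ofR _.
    by transitivity ((f x - f y * 1) * p + f y * p); [by []|ring].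
  by rewrite -mulr_sumr -ofR_sum sum_part mulCbE -mulrDr -ofRD subrKC ofR1 mulr1.
have E : psi (\sum_(y <- s) f y *: ofCb k (part P r s y)) = dirac_sum r s f.
  rewrite (scalar_fun_sum lin); apply: eq_bigr => y _.
  by rewrite (scalar_funZ lin) mulrC.
by rewrite {1}fE (scalar_funD lin) [X in _ + X - _](scalar_funD lin) E addrA addrK.
Qed.

Lemma osc_part_le r s (f : Cb K X) x (v : R) : 0 < r ->
  (forall y, d x y < 2 * r -> absR (f x - f y) <= v) ->
  absR (osc_part r s f x) <= v.
Proof.
move=> r0 h; have v0 : 0 <= v.
  have := h x; rewrite dist_xx subrr absR0; apply.
  by rewrite mulr_gt0.
rewrite /osc_part Cb_sum (le_trans (absR_sum _ _ _))//.
rewrite (@le_trans _ _ (\sum_(y <- s) v * part P r s y x))//.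
  apply: ler_sum => y _; rewrite mulCbE absRM absR_ofR ger0_norm ?part_ge0//.
  have [dy|dy] := ltP (d x y) (2 * r); last by rewrite part_far// !mulr0.
  by rewrite ler_wpM2r ?part_ge0// CbB CbZ /= mulr1 h.
by rewrite -mulr_sumr sum_part -[leRHS]mulr1 ler_wpM2l// gerBl rest_ge0.
Qed.

Lemma smooth_scale (u : Cb R X) (e : R) (M : nat) :
  (forall g : Cb K X, (forall x, absR (g x) <= u x) -> absR (psi g) <= e) ->
  forall g : Cb K X, (forall x, absR (g x) <= M.+1%:R * u x) ->
    absR (psi g) <= M.+1%:R * e.
Proof.
move=> h g gu; have M0 : (0 : R) < M.+1%:R by [].
have := h (ofR M.+1%:R^-1 *: g); rewrite (scalar_funZ lin) absRM absR_ofR.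
rewrite ger0_norm ?invr_ge0// mulrC ler_pdivrMr// mulrC; apply => x.
rewrite CbZ absRM absR_ofR ger0_norm ?invr_ge0// mulrC ler_pdivrMr// mulrC.
exact: gu.
Qed.

(** At scale [1 / (j + 1)] choose so many points that [psi] hardly sees the
    remainder. This choice does not depend on the family [L]; the oscillation of
    [L] enters only through the envelope, on which [psi] is small for large [j]. *)
Lemma dirac_approx : smooth psi -> exists N : nat -> nat,
  forall (L : set (Cb K X)) (M : nat),
    (forall f, L f -> forall x, absR (f x) <= M%:R) -> equicts P L ->
    forall e, 0 < e -> \forall j \near \oo, forall f, L f ->
      absR (psi f - dirac_sum j.+1%:R^-1 (first_points P (N j)) f) <= e.
Proof.
move=> sm; have inv0 n : (0 : R) < n.+1%:R^-1 by rewrite invr_gt0.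
have /choice[N NP] (j : nat) : exists N, forall g : Cb K X,
    (forall x, absR (g x) <= rest P j.+1%:R^-1 (first_points P N) x) ->
    absR (psi g) <= j.+1%:R^-1.
  apply: (sm (fun N => rest P j.+1%:R^-1 (first_points P N))) => //.
    by move=> n x; exact: rest_decr.
  move=> x e e0; have [n hn] := rest_eventually0 P x (inv0 j).
  by exists n; rewrite hn.
exists N => L M LM LE e e0; have e2 : 0 < e / 2 by rewrite divr_gt0.
have [V [Vdec V0 LV]] := oscillation_envelope LM LE.
have [n0 hn0] := sm V Vdec V0 _ e2.
have Vdecr := decreasing_le Vdec.
near=> j => f Lf; rewrite dirac_sumE (le_trans (absRD _ _))// (splitr e) lerD//.
  rewrite (@le_trans _ _ (M.+1%:R * j.+1%:R^-1))//.
    apply: (smooth_scale (NP j)) => x; rewrite mulCbE absRM absR_ofR.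
    rewrite (ger0_norm (rest_ge0 _ _ _ (inv0 j))) ler_wpM2r ?rest_ge0//.
    by rewrite (le_trans (LM f Lf x))// ler_nat.
  rewrite mulrC -ler_pdivlMr// ltW//; near: j.
  exact: (near_infty_natSinv_lt (PosNum (divr_gt0 e2 (ltr0Sn R M)))).
apply: hn0 => x; apply: osc_part_le => // y dxy.
rewrite (le_trans (LV j f x y Lf dxy))// Vdecr//; near: j.
exact: nbhs_infty_ge.
Unshelve. all: by end_near. Qed.

End one_functional.

(** Continuity on the colimit of k-ifications is tested on continuous images of
    compact spaces, where the limit is uniform. *)
Lemma continuous_unif_limit (psi : Cb K X -> K) (psi_ : nat -> Cb K X -> K) :
  (forall j, continuous (psi_ j)) ->
  (forall (L : set (Cb K X)) (M : nat),
    (forall f, L f -> forall x, absR (f x) <= M%:R) -> equicts P L ->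
    forall e, 0 < e -> \forall j \near \oo, forall f, L f ->
      absR (psi f - psi_ j f) <= e) ->
  continuous psi.
Proof.
move=> ch h; apply: Cb_continuous_from => n.
apply: continuous_from_kify => Q p cQ hQ cp.
have cp' : continuous (fun q => @Cb_incl K X n (p q)).
  move=> q; apply: (@continuous_comp _ (disk_maps K X n)).
    exact: (continuous_to_kify cQ hQ cp).
  exact: Cb_incl_continuous.
pose L := [set Cb_incl (p q) | q in [set: Q]].
have cL : compact L.
  by apply: continuous_compact => //; apply: continuous_subspaceT.
have [M LM] := compact_Cb_bounded cL.
have LE := compact_Cb_equicts P cL.
move=> q; apply/cvgK => e e0; have e4 : 0 < e / 4 by rewrite divr_gt0.
have [j _ /(_ j (leqnn j)) hj] := h L M LM LE _ e4.
have cj : (psi_ j \o (fun q => Cb_incl (p q))) x @[x --> q] --> psi_ j (Cb_incl (p q)).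
  apply: (@continuous_comp _ _ _ (fun q => Cb_incl (p q)) (psi_ j)).
    exact: cp'.
  exact: ch.
move/cvgK: cj => /(_ _ e4); apply: filterS => t /= tj.
have h1 := hj (Cb_incl (p t)) (ex_intro2 _ _ t I erefl).
have h2 := hj (Cb_incl (p q)) (ex_intro2 _ _ q I erefl).
have h3 := absR_dist (psi (Cb_incl (p t))) (psi_ j (Cb_incl (p t))) (psi (Cb_incl (p q))).
have h4 := absR_dist (psi_ j (Cb_incl (p t))) (psi_ j (Cb_incl (p q))) (psi (Cb_incl (p q))).
rewrite absRC in h2; move: h1 h2 h3 h4 tj e0; lra.
Qed.

Lemma natural_dual_of (psi : Cb K X -> K) : scalar psi -> continuous psi ->
  exists phi : natural_dual (Cb K X), natural_dual_fun phi = psi.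
Proof.
move=> lin cpsi.
pose phi : Cmaps (Cb K X) K := (mkcts cpsi : continuousType (Cb K X) K).
have lphi : natural_dual_set phi by exact: lin.
by exists (exist _ phi (mem_set lphi)).
Qed.

Lemma natural_dual_cvg_seq (phi_ : nat -> natural_dual (Cb K X))
    (phi : natural_dual (Cb K X)) :
  (forall (L : set (Cb K X)) (M : nat),
    (forall f, L f -> forall x, absR (f x) <= M%:R) -> equicts P L ->
    forall e, 0 < e -> \forall j \near \oo, forall f, L f ->
      absR (natural_dual_fun phi f - natural_dual_fun (phi_ j) f) <= e) ->
  phi_ @ \oo --> phi.
Proof.
move=> h; apply: cvg_initial; apply: Cmaps_cvg_seq => Q O cQ oO QO.
have [M QM] := compact_Cb_bounded cQ; have hQ := h Q M QM (compact_Cb_equicts P cQ).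
have phic : continuous (natural_dual_fun phi) by exact: cmap_cts.
have cov : \forall j \near \oo, Q `<=` (fun f => O (natural_dual_fun (phi_ j) f)).
  move/compact_near_coveringP/near_covering_withinP : cQ; apply => f Qf.
  have /nbhsK[e e0 eO] : nbhs (natural_dual_fun phi f) O.
    by apply: open_nbhs_nbhs; split => //; apply: QO; exists f.
  have e2 : 0 < e / 2 by rewrite divr_gt0.
  have /cvgK/(_ _ e2) nf := phic f.
  near=> g j => /= Qg; apply: eO.
  have hj : forall f, Q f -> absR (natural_dual_fun phi f - natural_dual_fun (phi_ j) f) <= e / 2.
    by near: j; exact: hQ.
  rewrite (le_lt_trans (absR_dist _ (natural_dual_fun phi g) _))// (splitr e).
  rewrite ler_ltD//; last by near: g.
  by rewrite absRC; exact: hj.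
by apply: filterS cov => j hj z [f Qf <-]; exact: hj.
Unshelve. all: by end_near. Qed.

Lemma dirac_sum_continuous psi r s : continuous (dirac_sum psi r s).
Proof.
have h (a : X -> K) : continuous (fun f : Cb K X => \sum_(y <- s) a y * f y).
  move=> f; elim: s => [|y t IH].
    rewrite (_ : (fun f => _) = cst 0); last by apply/funext => g; rewrite big_nil.
    exact: cst_continuous.
  rewrite (_ : (fun f => _) = (fun g : Cb K X => a y * g y + \sum_(z <- t) a z * g z)).
    apply: (@cvgD _ _ _ (nbhs f)); last exact: IH.
    apply: (@cvgM _ _ (nbhs f)); first exact: cvg_cst.
    exact: Cb_eval_continuous.
  by apply/funext => g; rewrite big_cons.
exact: h.
Qed.

(** The Dirac combinations of [dirac_approx] approach [psi] uniformly on compact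
    sets: this makes [psi] continuous and puts it in the closure of their span. *)
Lemma smooth_Mspace (psi : Cb K X -> K) : scalar psi -> smooth psi ->
  exists2 phi : natural_dual (Cb K X), natural_dual_fun phi = psi & Mspace phi.
Proof.
move=> lin sm; have [N hN] := dirac_approx lin sm.
have cpsi : continuous psi.
  by apply: continuous_unif_limit hN => j; exact: dirac_sum_continuous.
have [phi phiE] := natural_dual_of lin cpsi; exists phi => //.
have /choice[phi_ phi_E] (j : nat) : exists phi_ : natural_dual (Cb K X),
    natural_dual_fun phi_ = dirac_sum psi j.+1%:R^-1 (first_points P (N j)).
  apply: natural_dual_of; last exact: dirac_sum_continuous.
  move=> a f g; rewrite /dirac_sum mulr_sumr -big_split; apply: eq_bigr => y _.
  by rewrite CbD CbZ /=; ring.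
have cvg_phi : phi_ @ \oo --> phi.
  apply: natural_dual_cvg_seq => L M LM LE e e0.
  apply: filterS (hN L M LM LE e e0) => j hj f Lf.
  by rewrite phiE phi_E; exact: hj.
move=> U Uphi; have [j _ /(_ j (leqnn j)) Uj] := cvg_phi U Uphi.
exists (phi_ j); split => //.
set s := first_points P (N j) in phi_E.
exists (size s), (fun i => psi (ofCb k (part P j.+1%:R^-1 s (tnth (in_tuple s) i)))).
exists (tnth (in_tuple s)) => f.
by rewrite phi_E /dirac_sum big_tnth.
Qed.

End dirac_approximation.


(** * Variation and integral of scalar measures *)

Section scalar_measure.
Variables (R : realType) (k : scalar_kind) (X : topologicalType).
Local Notation K := (scalars R k).
Variables (S : set (set X)) (mu : set X -> K).
Hypotheses (sS : sigma_algebra setT S) (mmu : is_measure S mu).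

Lemma sigma0 : S set0. Proof. by have [] := sS. Qed.
Lemma sigmaC A : S A -> S (~` A).
Proof. by have [_ h _] := sS; rewrite -setTD; exact: h. Qed.
Lemma sigmaT : S setT. Proof. by rewrite -setC0; exact/sigmaC/sigma0. Qed.
Lemma sigma_bigU (F : nat -> set X) : (forall n, S (F n)) -> S (\bigcup_n F n).
Proof. by have [_ _] := sS; exact. Qed.
Lemma sigmaU A B : S A -> S B -> S (A `|` B).
Proof.
move=> SA SB; rewrite -bigcup2E; apply: sigma_bigU => -[|[|n]] //=; exact: sigma0.
Qed.
Lemma sigmaI A B : S A -> S B -> S (A `&` B).
Proof.
by move=> SA SB; rewrite -(setCK (A `&` B)) setCI; apply/sigmaC/sigmaU; exact: sigmaC.
Qed.
Lemma sigmaD A B : S A -> S B -> S (A `\` B).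
Proof. by move=> SA SB; rewrite setDE; apply: sigmaI => //; exact: sigmaC. Qed.
Lemma sigma_fin (T : choiceType) (s : seq T) (F : T -> set X) :
  (forall t, S (F t)) -> S (\big[setU/set0]_(t <- s) F t).
Proof. by move=> SF; elim/big_ind : _ => //; [exact: sigma0|exact: sigmaU]. Qed.

(** The constant sequence of empty sets makes [n * mu set0] convergent. *)
Lemma mu_set0 : mu set0 = 0.
Proof.
have h := mmu.1 (fun=> set0) (fun=> sigma0) (@trivIset_set0 _ _ _).
rewrite bigcup0// in h; apply: absR_small => e e0.
have e2 : 0 < e / 2 by rewrite divr_gt0.
have /cvgK/(_ _ e2)[n _ hn] := h.
have := hn n (leqnn n); have := hn n.+1 (leqnSn n) => /=.
rewrite !big_const_ord !iter_addr_0 mulrS; set a := mu set0; set b := a *+ n.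
move=> h1 h2; have -> : a = (a + b - a) - (b - a) by ring.
rewrite (le_trans (absRD _ _))// absRN; move: h1 h2; lra.
Qed.

Lemma mu_setU A B : S A -> S B -> A `&` B = set0 -> mu (A `|` B) = mu A + mu B.
Proof.
move=> SA SB AB; have Sb n : S (bigcup2 A B n) by case: n => [|[|n]]//=; exact: sigma0.
have tb : trivIset setT (bigcup2 A B) by rewrite -trivIset_bigcup2.
have /cvgK h := mmu.1 _ Sb tb.
apply/eqP; rewrite eq_sym -subr_eq0; apply/eqP; apply: absR_small => e e0.
have [n _ hn] := h e e0.
have := hn n.+2 (leq_trans (leqnSn n) (leqnSn _)) => /=.
rewrite !big_ord_recl /= big1 ?addr0 => [|i _]; last exact: mu_set0.
by rewrite bigcup2E => /ltW.
Qed.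

Lemma mu_setD A B : S A -> S B -> B `<=` A -> mu (A `\` B) = mu A - mu B.
Proof.
move=> SA SB BA; apply/eqP; rewrite eq_sym subr_eq addrC -mu_setU//; last 2 first.
- exact: sigmaD.
- by rewrite setDE setICA setICr setI0.
by rewrite setDE setUIr setUCr setIT setUidr.
Qed.

Lemma mu_fin (T : finType) (F : T -> set X) : (forall t, S (F t)) ->
  trivIset setT F -> mu (\bigcup_t F t) = \sum_t mu (F t).
Proof.
move=> SF tF.
have h (s : seq T) : uniq s -> mu (\big[setU/set0]_(t <- s) F t) = \sum_(t <- s) mu (F t).
  elim: s => [|t s IH] /=; first by rewrite !big_nil mu_set0.
  move=> /andP[ts us]; rewrite !big_cons mu_setU ?IH//; first exact: sigma_fin.
  rewrite -bigcup_seq -subset0 => x [Fx [u /= us' Fu]].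
  have tu : t = u by apply: tF => //; exists x.
  by move: ts; rewrite tu us'.
rewrite -(h (index_enum T) (index_enum_uniq T)) -bigcup_seq; congr mu.
by apply: eq_bigcupl; split => t //= _; exact: mem_index_enum.
Qed.

(** Adding the complement of the union turns the family into a partition of [B]. *)
Lemma variation_ge (T : finType) (F : T -> set X) (B : set X) : S B ->
  (forall t, S (F t)) -> trivIset setT F -> (forall t, F t `<=` B) ->
  ((\sum_t absR (mu (F t)))%:E <= scalar_variation S mu B)%E.
Proof.
move=> SB SF tF FB.
pose G (o : option T) := if o is Some t then F t else B `\` \bigcup_t F t.
have SU : S (\bigcup_t F t).
  rewrite (_ : \bigcup_t F t = \big[setU/set0]_(t <- enum T) F t); first exact: sigma_fin.
  by rewrite -bigcup_seq; apply: eq_bigcupl; split => t //= _; rewrite mem_enum.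
have SG o : S (G o) by case: o => [t|] //=; exact: sigmaD.
have tG : trivIset setT G.
  move=> [t|] [u|] // _ _ [x []] /=.
  - by move=> Ft Fu; congr Some; apply: tF => //; exists x.
  - by move=> Ft [_]; case; exists t.
  - by move=> [_ nF] Fu; case: nF; exists u.
have UG : \bigcup_o G o = B.
  apply/seteqP; split => [x [[t|] _ /=]|x Bx]; [exact: FB|by case|].
  have [[t _ Ft]|nF] := pselect ((\bigcup_t F t) x); first by exists (Some t).
  by exists None.
apply: (@le_trans _ _ (\sum_o absR (mu (G o)))%:E).
  rewrite lee_fin (bigD1 None)//= (reindex_omap Some id) => [|[]]//=.
  rewrite [leLHS](_ : _ = \sum_(j | (Some j != None) && (Some j == Some j)) absR (mu (F j))).
    by rewrite lerDr absR_ge0.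
  by apply: eq_bigl => t; rewrite eqxx.
apply: ereal_sup_ubound; exists #|{: option T}|, (fun i => G (enum_val i)); split.
  split => [i //|i j _ _ ij|]; first exact/enum_val_inj/tG.
  rewrite -UG; apply/seteqP; split => x [q _ Gq]; first by exists (enum_val q).
  by exists (enum_rank q) => //; rewrite enum_rankK.
by rewrite -(@big_enum_val _ _ _ _ {: option T} (fun o => absR (mu (G o)))).
Qed.

Definition variationR (A : set X) : R := fine (scalar_variation S mu A).
Local Notation nu := variationR.

Lemma variationE A : S A -> scalar_variation S mu A = (nu A)%:E.
Proof.
move=> SA; rewrite /variationR fineK// fin_numE; apply/andP; split.
  rewrite gt_eqF// (lt_le_trans (ltNyr 0))//.
  have := @variation_ge void (fun=> set0) A SA (fun=> sigma0) (@trivIset_set0 _ _ _).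
  by rewrite big1; [apply; case|case].
rewrite lt_eqF// (le_lt_trans _ mmu.2)//; apply: ge_ereal_sup => _ [n [F [[SF tF UF] ->]]].
exact: variation_ge sigmaT _ _ _.
Qed.

Lemma variation_fin_ge (T : finType) (F : T -> set X) (B : set X) : S B ->
  (forall t, S (F t)) -> trivIset setT F -> (forall t, F t `<=` B) ->
  \sum_t absR (mu (F t)) <= nu B.
Proof. by move=> SB SF tF FB; rewrite -lee_fin -variationE//; exact: variation_ge. Qed.

Lemma variation_le A (c : R) : S A ->
  (forall n (F : 'I_n -> set X), finite_partition S A F -> \sum_i absR (mu (F i)) <= c) ->
  nu A <= c.
Proof.
move=> SA h; rewrite -lee_fin -variationE//; apply: ge_ereal_sup => _ [n [F [pF ->]]].
by rewrite lee_fin; exact: h.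
Qed.

Lemma variation_ge0 A : S A -> 0 <= nu A.
Proof.
move=> SA; have := @variation_fin_ge void (fun=> set0) A SA (fun=> sigma0) (@trivIset_set0 _ _ _).
by rewrite big1; [apply; case|case].
Qed.

Lemma variation_approx A (e : R) : S A -> 0 < e ->
  exists n (F : 'I_n -> set X), finite_partition S A F /\ nu A - e < \sum_i absR (mu (F i)).
Proof.
move=> SA e0; apply: contrapT => nh.
have : nu A <= nu A - e.
  apply: variation_le => // n F pF; rewrite leNgt; apply/negP => h; apply: nh.
  by exists n, F.
by rewrite leNgt => /negP; apply; rewrite ltrBlDr ltrDl.
Qed.

Lemma variation_mono A B : S A -> S B -> A `<=` B -> nu A <= nu B.
Proof.
move=> SA SB AB; apply: variation_le => // n F [SF tF UF]; apply: variation_fin_ge => //.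
by move=> t x Fx; apply: AB; rewrite -UF; exists t.
Qed.

Lemma trivIset_setI (T : Type) (F : T -> set X) A : trivIset setT F ->
  trivIset setT (fun t => F t `&` A).
Proof. by move=> tF i j _ _ [x [[Fi _] [Fj _]]]; apply: tF => //; exists x. Qed.

Lemma variation_subadd A B : S A -> S B -> nu (A `|` B) <= nu A + nu B.
Proof.
move=> SA SB; apply: variation_le; first exact: sigmaU.
move=> n F [SF tF UF].
rewrite (@le_trans _ _ (\sum_i (absR (mu (F i `&` A)) + absR (mu (F i `&` ~` A)))))//.
  apply: ler_sum => i _; rewrite (le_trans _ (absRD _ _))// -mu_setU ?setIUr//.
  - by rewrite -setIUr setUCr setIT.
  - exact: sigmaI.
  - by apply: sigmaI => //; exact: sigmaC.
  - by rewrite setIACA setICr setI0.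
rewrite big_split /= lerD//; apply: variation_fin_ge => //.
- by move=> t; exact: sigmaI.
- exact: trivIset_setI.
- by move=> t; apply: sigmaI => //; exact: sigmaC.
- exact: trivIset_setI.
- move=> t x [Fx nA]; have : (A `|` B) x by rewrite -UF; exists t.
  by case.
Qed.

Lemma variation_superadd A B : S A -> S B -> A `&` B = set0 ->
  nu A + nu B <= nu (A `|` B).
Proof.
move=> SA SB AB; apply/ler_addgt0Pr => e e0; have e2 : 0 < e / 2 by rewrite divr_gt0.
have [n [F [[SF tF UF] hF]]] := variation_approx SA e2.
have [m [G [[SG tG UG] hG]]] := variation_approx SB e2.
pose H (s : 'I_n + 'I_m) := match s with inl i => F i | inr j => G j end.
have FA i : F i `<=` A by move=> x Fx; rewrite -UF; exists i.
have GB i : G i `<=` B by move=> x Gx; rewrite -UG; exists i.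
have := @variation_fin_ge _ H (A `|` B) (sigmaU SA SB).
rewrite big_sumType /= => h.
suff : \sum_i absR (mu (F i)) + \sum_i absR (mu (G i)) <= nu (A `|` B) by lra.
apply: h.
- by case=> i /=.
- have dis x : A x -> B x -> False by move=> Ax Bx; have : (A `&` B) x by []; rewrite AB.
  move=> [i|i] [j|j] _ _ [x [/= Hi Hj]].
  + by congr inl; apply: tF => //; exists x.
  + by case: (dis x); [exact: FA Hi|exact: GB Hj].
  + by case: (dis x); [exact: FA Hj|exact: GB Hi].
  + by congr inr; apply: tG => //; exists x.
- by move=> [i|i] x /= Hx; [left; exact: FA Hx|right; exact: GB Hx].
Qed.

Lemma mu_decr_cvg0 (E : nat -> set X) : (forall n, S (E n)) ->
  (forall n, E n.+1 `<=` E n) -> \bigcap_n E n = set0 ->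
  forall e, 0 < e -> \forall n \near \oo, absR (mu (E n)) < e.
Proof.
move=> SE dE E0 e e0; pose D n := E n `\` E n.+1.
have SD n : S (D n) by exact: sigmaD.
have decE m n : (m <= n)%N -> E n `<=` E m.
  by move=> mn; rewrite -(subnK mn) addnC; elim: (n - m)%N => [|q IH];
    rewrite ?addn0// addnS => x /dE; exact: IH.
have tD : trivIset setT D.
  apply: ltn_trivIset => j i ij; rewrite -subset0 => x [[Ei nEi] [Ej nEj]].
  by apply: nEi; exact: decE Ej.
have UD : \bigcup_n D n = E 0%N.
  apply/seteqP; split => [x [n _ [/decE + _]]|x Ex]; first exact.
  apply: contrapT => nx; suff : (\bigcap_n E n) x by rewrite E0.
  move=> n _; elim: n => // n En; apply: contrapT => nE; apply: nx.
  by exists n.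
have /cvgK/(_ e e0) := mmu.1 D SD tD; apply: filterS => n.
rewrite UD; suff -> : \sum_(i < n) mu (D i) = mu (E 0%N) - mu (E n).
  by rewrite addrC addKr absRN.
elim: n => [|n IH]; first by rewrite big_ord0 subrr.
by rewrite big_ord_recr /= IH mu_setD//; ring.
Qed.

(** A partition of [E 0] almost realising the variation loses, when the [E n]
    are removed, only finitely many small measures; so [E 0 `\` E n] carries
    almost all of the variation. *)
Lemma variation_decr_cvg0 (E : nat -> set X) : (forall n, S (E n)) ->
  (forall n, E n.+1 `<=` E n) -> \bigcap_n E n = set0 ->
  forall e, 0 < e -> exists n, nu (E n) < e.
Proof.
move=> SE dE E0 e e0; have e2 : 0 < e / 2 by rewrite divr_gt0.
have [m [F [[SF tF UF] hF]]] := variation_approx (SE 0%N) e2.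
have q0 : 0 < e / 2 / m.+1%:R by rewrite divr_gt0.
have hn : \forall n \near \oo, forall i, absR (mu (F i `&` E n)) < e / 2 / m.+1%:R.
  apply: filter_forall => i; apply: mu_decr_cvg0 => //.
  - by move=> n; exact: sigmaI.
  - by move=> n; exact: setIS.
  - by rewrite bigcapIr ?E0 ?setI0//; exists 0%N.
have [n _ /(_ n (leqnn n)) {}hn] := hn; exists n.
have decE : E n `<=` E 0%N by elim: n {hn} => // n IH; exact: subset_trans (dE n) _.
have h1 : \sum_i absR (mu (F i)) <= nu (E 0%N `\` E n) + \sum_(i < m) e / 2 / m.+1%:R.
  rewrite (@le_trans _ _ (\sum_i (absR (mu (F i `&` ~` E n)) + absR (mu (F i `&` E n)))))//.
    apply: ler_sum => i _; rewrite (le_trans _ (absRD _ _))// -mu_setU.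
    - by rewrite -setIUr setvU setIT.
    - by apply: sigmaI => //; exact: sigmaC.
    - exact: sigmaI.
    - by rewrite setIACA setICl setI0.
  rewrite big_split /= lerD//; last by apply: ler_sum => i _; exact: ltW.
  apply: variation_fin_ge.
  - exact: sigmaD.
  - by move=> i; apply: sigmaI => //; exact: sigmaC.
  - exact: trivIset_setI.
  - by move=> i x [Fx nE]; split => //; rewrite -UF; exists i.
have h2 := variation_superadd (sigmaD (SE 0%N) (SE n)) (SE n).
have /h2 {}h2 : (E 0%N `\` E n) `&` E n = set0 by rewrite setDKI.
rewrite [_ `|` _](_ : _ = E 0%N) in h2; last by rewrite setUC setDUK.
have h3 : \sum_(i < m) e / 2 / m.+1%:R < e / 2.
  rewrite sumr_const card_ord -[_ *+ m]mulr_natr -mulrA gtr_pMr// mulrC ltr_pdivrMr// mul1r.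
  by rewrite ltr_nat.
move: hF h1 h2 h3; lra.
Qed.

Lemma variation_bigU_le (E : nat -> set X) (c : R) : (forall n, S (E n)) ->
  (forall n, \sum_(i < n) nu (E i) <= c) -> nu (\bigcup_n E n) <= c.
Proof.
move=> SE hc; apply/ler_addgt0Pr => e e0.
pose U n := \bigcup_i E i `\` \big[setU/set0]_(i < n) E i.
have Sn n : S (\big[setU/set0]_(i < n) E i) by exact: sigma_fin.
have SU n : S (U n) by apply: sigmaD => //; exact: sigma_bigU.
have dU n : U n.+1 `<=` U n.
  by move=> x [Ex nE]; split => // h; apply: nE; rewrite big_ord_recr /=; left.
have U0 : \bigcap_n U n = set0.
  rewrite -subset0 => x Ux; have [[n _ En] _] := Ux 0%N I.
  by have [_ +] := Ux n.+1 I; apply; rewrite big_ord_recr /=; right.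
have [n hn] := variation_decr_cvg0 SU dU U0 e0.
have -> : \bigcup_i E i = \big[setU/set0]_(i < n) E i `|` U n.
  rewrite /U setDUK// => x; rewrite -bigcup_mkord => -[i _ Ei]; by exists i.
rewrite (le_trans (variation_subadd _ _))// lerD ?(ltW hn)// (le_trans _ (hc n))//.
elim: n {hn} => [|n IH].
  rewrite !big_ord0; apply: variation_le; first exact: sigma0.
  move=> n F [_ _ UF]; rewrite big1// => i _.
  rewrite (_ : F i = set0) ?mu_set0 ?absR0// -subset0 => x Fx.
  by rewrite -UF; exists i.
rewrite !big_ord_recr /= (le_trans (variation_subadd (Sn n) (SE n)))//.
by rewrite lerD2r.
Qed.

(** * Integration of bounded continuous functions *)

Hypothesis oS : forall A, open A -> S A.
Local Notation V := (nu setT).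

Lemma closed_sigma A : closed A -> S A.
Proof. by move=> cA; rewrite -(setCK A); apply/sigmaC/oS/closed_openC. Qed.

(** Finite measurable partitions are encoded as maps to a finite type, so that
    common refinements are just pairings. *)
Definition measq (T : finType) (q : X -> T) := forall t, S (q @^-1` [set t]).

Definition simple_int (T : finType) (q : X -> T) (c : T -> K) : K :=
  \sum_t c t * mu (q @^-1` [set t]).

Lemma measq_pair (T U : finType) (q : X -> T) (q' : X -> U) :
  measq q -> measq q' -> measq (fun x => (q x, q' x)).
Proof.
move=> mq mq' [t u]; rewrite (_ : _ @^-1` _ = q @^-1` [set t] `&` q' @^-1` [set u]).
  exact: sigmaI.
by apply/seteqP; split => x /= [-> ->].
Qed.

Lemma simple_int_refine (T U : finType) (q : X -> T) (q' : X -> U) (c : T -> K) :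
  measq q -> measq q' ->
  simple_int q c = simple_int (fun x => (q x, q' x)) (fun p => c p.1).
Proof.
move=> mq mq'; rewrite /simple_int.
transitivity (\sum_t \sum_u c t * mu ((fun x => (q x, q' x)) @^-1` [set (t, u)])).
  2: by rewrite pair_big /=; apply: eq_bigr => -[].
apply: eq_bigr => t _; rewrite -mulr_sumr; congr (_ * _).
rewrite -mu_fin.
- congr mu; apply/seteqP; split => x /=; first by move=> <-; exists (q' x).
  by move=> [u _ /= [-> _]].
- by move=> u; exact: measq_pair.
- by move=> u v _ _ [x [/= [_ <-] [_ <-]]].
Qed.

Lemma simple_int_swap (T U : finType) (q : X -> T) (q' : X -> U) (c : U -> K) :
  measq q -> measq q' ->
  simple_int q' c = simple_int (fun x => (q x, q' x)) (fun p => c p.2).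
Proof.
move=> mq mq'; rewrite /simple_int.
transitivity (\sum_t \sum_u c u * mu ((fun x => (q x, q' x)) @^-1` [set (t, u)])).
  2: by rewrite pair_big /=; apply: eq_bigr => -[].
rewrite exchange_big /=; apply: eq_bigr => u _; rewrite -mulr_sumr; congr (_ * _).
rewrite -mu_fin.
- congr mu; apply/seteqP; split => x /=; first by move=> <-; exists (q x).
  by move=> [t _ /= [_ ->]].
- by move=> t; exact: measq_pair.
- by move=> t v _ _ [x [/= [<- _] [<- _]]].
Qed.

Lemma simple_int_le (T : finType) (q : X -> T) (c : T -> K) (A : set X) (a b : R) :
  measq q -> S A -> 0 <= a -> 0 <= b ->
  (forall x, A x -> absR (c (q x)) <= a) ->
  (forall x, ~ A x -> absR (c (q x)) <= b) ->
  absR (simple_int q c) <= a * nu A + b * nu (~` A).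
Proof.
move=> mq SA a0 b0 ha hb.
have SF t : S (q @^-1` [set t]) := mq t.
have h (B : set X) v : S B -> 0 <= v -> (forall x, B x -> absR (c (q x)) <= v) ->
    \sum_t absR (c t * mu (q @^-1` [set t] `&` B)) <= v * nu B.
  move=> SB v0 hv; rewrite (@le_trans _ _ (\sum_t v * absR (mu (q @^-1` [set t] `&` B))))//.
    apply: ler_sum => t _; rewrite absRM.
    have [[x [/= <- Bx]]|/nonemptyPn ->] := pselect (q @^-1` [set t] `&` B !=set0).
      by rewrite ler_wpM2r ?absR_ge0// hv.
    by rewrite mu_set0 absR0 !mulr0.
  rewrite -mulr_sumr ler_wpM2l//; apply: variation_fin_ge => //.
  - by move=> t; exact: sigmaI.
  - by apply: trivIset_setI => i j _ _ [x [/= <- <-]].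
rewrite (le_trans (absR_sum _ _ _))//.
rewrite (@le_trans _ _ (\sum_t (absR (c t * mu (q @^-1` [set t] `&` A)) +
    absR (c t * mu (q @^-1` [set t] `&` ~` A)))))//.
  apply: ler_sum => t _; rewrite (le_trans _ (absRD _ _))// -mulrDr -mu_setU.
  - by rewrite -setIUr setUv setIT.
  - exact: sigmaI.
  - by apply: sigmaI => //; exact: sigmaC.
  - by rewrite setIACA setICr setI0.
by rewrite big_split lerD// h//; exact: sigmaC.
Qed.

Lemma simple_int_dist (T U : finType) (q : X -> T) (q' : X -> U) (c : T -> K)
    (c' : U -> K) (e : R) : measq q -> measq q' -> 0 <= e ->
  (forall x, absR (c (q x) - c' (q' x)) <= e) ->
  absR (simple_int q c - simple_int q' c') <= e * V.
Proof.
move=> mq mq' e0 h.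
rewrite (simple_int_refine _ mq mq') (simple_int_swap _ mq mq').
rewrite {1 2}/simple_int -sumrB.
under eq_bigr do rewrite -mulrBl.
have := @simple_int_le _ (fun x => (q x, q' x)) (fun p => c p.1 - c' p.2) setT e 0
  (measq_pair mq mq') sigmaT e0 (lexx 0) (fun x _ => h x).
by rewrite mul0r addr0; apply => x /= [].
Qed.

Lemma quantize_real (u : Cb R X) (e : R) : 0 < e ->
  exists n (q : X -> 'I_n) (c : 'I_n -> R),
    measq q /\ forall x, `|u x - c (q x)| <= e.
Proof.
move=> e0; have [B uB] := CbR_bounded u.
have lo x : 0 <= (u x + B%:R) / e.
  by rewrite divr_ge0 ?(ltW e0)//; have := uB x; rewrite ler_norml => /andP[]; lra.
pose n := (Num.truncn (2 * B%:R / e)).+1.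
have hi x : (Num.truncn ((u x + B%:R) / e) < n)%N.
  rewrite ltnS; apply: le_truncn; rewrite ler_pM2r ?invr_gt0//.
  by have := uB x; rewrite ler_norml => /andP[]; lra.
exists n, (fun x => Ordinal (hi x)), (fun i => (i : nat)%:R * e - B%:R); split.
  move=> i.
  rewrite (_ : _ @^-1` _ = [set x | i%:R * e - B%:R <= u x] `\`
      [set x | i.+1%:R * e - B%:R <= u x]).
    have cl a : closed [set x | a <= u x].
      exact: (@preimage_closed _ _ u [set y | a <= y]
        (fun x _ => @Cb_cts _ _ u x) (@closed_ge _ a)).
    by apply: sigmaD; exact: closed_sigma.
  apply/seteqP; split => x /=.
    move=> <- /=; have := truncn_itv (lo x); set m := Num.truncn _.
    rewrite ler_pdivlMr// ltr_pdivrMr// => /andP[h1 h2]; split; first lra.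
    by apply/negP; rewrite -ltNge; lra.
  move=> [h1 /negP]; rewrite -ltNge => h2; apply: val_inj => /=; apply: truncn_def.
  by rewrite ler_pdivlMr// ltr_pdivrMr//; apply/andP; split; lra.
move=> x /=; have := truncn_itv (lo x); set m := Num.truncn _.
rewrite ler_pdivlMr// ltr_pdivrMr// -addn1 natrD mulrDl mul1r ler_norml.
by move=> /andP[h1 h2]; apply/andP; split; lra.
Qed.

Lemma quantize (f : Cb K X) (e : R) : 0 < e ->
  exists (T : finType) (q : X -> T) (c : T -> K),
    measq q /\ forall x, absR (f x - c (q x)) <= e.
Proof.
move=> e0; have e2 : 0 < e / 2 by rewrite divr_gt0.
have [n [q [c [mq hq]]]] := quantize_real (reCb f) e2.
have [m [q' [c' [mq' hq']]]] := quantize_real (imCb f) e2.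
exists ('I_n * 'I_m)%type, (fun x => (q x, q' x)), (fun p => ofR (c p.1) + jK * ofR (c' p.2)).
split; first exact: measq_pair.
move=> x /=; rewrite {1}(K_decomp (f x)).
have -> : ofR (reK (f x)) + jK * ofR (imK (f x)) - (ofR (c (q x)) + jK * ofR (c' (q' x)))
   = ofR (reCb f x - c (q x)) + jK * ofR (imCb f x - c' (q' x)) :> K.
  by rewrite !ofRB /=; ring.
rewrite (le_trans (absRD _ _))// absRM !absR_ofR (splitr e) lerD//.
by rewrite (le_trans _ (hq' x))// ler_piMl// absR_jK.
Qed.

(** Two simple approximations of [f] have close integrals by [simple_int_dist], so
    any sequence of ever finer ones is Cauchy. *)
Lemma integral_exists (f : Cb K X) : exists v : K,
  forall (e : R) (T : finType) (q : X -> T) (c : T -> K), 0 <= e -> measq q ->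
    (forall x, absR (f x - c (q x)) <= e) -> absR (v - simple_int q c) <= e * V.
Proof.
have inv0 n : (0 : R) < n.+1%:R^-1 by rewrite invr_gt0.
pose good n (s : K) := exists (T : finType) (q : X -> T) (c : T -> K),
  [/\ measq q, forall x, absR (f x - c (q x)) <= n.+1%:R^-1 & s = simple_int q c].
have /choice[s sP] n : exists s, good n s.
  by have [T [q [c [mq hq]]]] := quantize f (inv0 n); exists (simple_int q c), T, q, c.
have key (e : R) (T : finType) (q : X -> T) (c : T -> K) n : 0 <= e -> measq q ->
    (forall x, absR (f x - c (q x)) <= e) ->
    absR (s n - simple_int q c) <= (n.+1%:R^-1 + e) * V.
  move=> e0 mq hq; have [T' [q' [c' [mq' hq' ->]]]] := sP n.
  apply: simple_int_dist => //; first by rewrite addr_ge0// ltW.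
  move=> x; rewrite (le_trans (absR_dist _ (f x) _))// lerD//.
  by rewrite absRC.
have V0 : 0 <= V by apply: variation_ge0; exact: sigmaT.
have [v hv] : exists v : K, s @ \oo --> v.
  apply: K_complete => e e0.
  have q0 : 0 < e / 2 / (V + 1) by rewrite !divr_gt0// ltr_wpDl.
  have [n _ hn] := near_infty_natSinv_lt (PosNum q0).
  exists (s n); exists n => // m /= nm.
  have [T [q [c [mq hq ->]]]] := sP n.
  rewrite (le_lt_trans (key _ _ _ _ m (ltW (inv0 n)) mq hq))//.
  have := hn n (leqnn n); have := hn m nm => /=.
  have V1 : 0 < V + 1 by rewrite ltr_wpDl.
  rewrite !ltr_pdivlMr//; have := inv0 n; have := inv0 m.
  set a := _^-1; set b := _^-1; nra.
exists v => e T q c e0 mq hq; apply/ler_addgt0Pr => r r0.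
have r2 : 0 < r / 2 by rewrite divr_gt0.
have q0 : 0 < r / 2 / (V + 1) by rewrite !divr_gt0// ltr_wpDl.
move/cvgK/(_ _ r2) : hv => hv.
have [n [h1 h2]] : exists n, absR (s n - v) < r / 2 /\ n.+1%:R^-1 < r / 2 / (V + 1).
  have [n _ /(_ n (leqnn n)) h] := filterI hv (near_infty_natSinv_lt (PosNum q0)).
  by exists n.
have h3 := key e T q c n e0 mq hq.
rewrite (le_trans (absR_dist _ (s n) _))// absRC.
move: h2; have V1 : 0 < V + 1 by rewrite ltr_wpDl.
rewrite ltr_pdivlMr// => h2; have := inv0 n; move: h2 h3; set a := _^-1 => h2 h3 a0.
have aV : a * V <= r / 2 by nra.
move: h3; rewrite mulrDl; move: h1 aV; lra.
Qed.

Definition integral_fun : Cb K X -> K := projT1 (choice integral_exists).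

Lemma integral_funP (f : Cb K X) (e : R) (T : finType) (q : X -> T) (c : T -> K) : 0 <= e ->
  measq q -> (forall x, absR (f x - c (q x)) <= e) ->
  absR (integral_fun f - simple_int q c) <= e * V.
Proof. exact: (projT2 (choice integral_exists) f). Qed.

Lemma variationT_ge0 : 0 <= V. Proof. exact/variation_ge0/sigmaT. Qed.

Lemma integral_fun_scalar : scalar integral_fun.
Proof.
move=> a f g; apply/eqP; rewrite -subr_eq0; apply/eqP; apply: absR_small => e e0.
have V0 := variationT_ge0; have a0 := absR_ge0 a.
pose W := 2 * (absR a + 1) * (V + 1).
have W0 : 0 < W by rewrite !mulr_gt0// ltr_wpDl.
have d0 : 0 < e / W by rewrite divr_gt0.
have dW : e / W * W = e by rewrite divfK// gt_eqF.
move: d0 dW; set d := e / W => d0 dW.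
have [T [q [c [mq hq]]]] := quantize f d0.
have [U [q' [c' [mq' hq']]]] := quantize g d0.
have h1 := integral_funP (ltW d0) mq hq.
have h2 := integral_funP (ltW d0) mq' hq'.
have e1 : 0 <= absR a * d + d by apply: addr_ge0; [apply: mulr_ge0 => //|]; exact: ltW.
have E : simple_int (fun x => (q x, q' x)) (fun p => a * c p.1 + c' p.2) =
    a * simple_int q c + simple_int q' c'.
  rewrite (simple_int_refine _ mq mq') (simple_int_swap _ mq mq') /simple_int.
  rewrite mulr_sumr -big_split; apply: eq_bigr => p _ /=.
  by rewrite mulrDl mulrA.
have h3 : absR (integral_fun (a *: f + g) - (a * simple_int q c + simple_int q' c'))
    <= (absR a * d + d) * V.
  rewrite -E; apply: integral_funP => //; first exact: measq_pair.
  move=> x; rewrite CbD CbZ.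
  have -> : a * f x + g x - (a * c (q x) + c' (q' x)) =
    a * (f x - c (q x)) + (g x - c' (q' x)) by ring.
  by rewrite (le_trans (absRD _ _))// absRM lerD// ler_wpM2l.
have -> : integral_fun (a *: f + g) - (a * integral_fun f + integral_fun g) =
    (integral_fun (a *: f + g) - (a * simple_int q c + simple_int q' c')) +
    (- (a * (integral_fun f - simple_int q c)) - (integral_fun g - simple_int q' c')).
  by ring.
rewrite (le_trans (absRD _ _))//.
have h4 : absR (- (a * (integral_fun f - simple_int q c)) - (integral_fun g - simple_int q' c'))
    <= absR a * (d * V) + d * V.
  by rewrite (le_trans (absRD _ _))// !absRN absRM lerD// ler_wpM2l.
rewrite (le_trans (lerD h3 h4))// -[leRHS]dW /W.
have h5 : 0 <= absR a * d by rewrite mulr_ge0// ltW.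
have -> : (absR a * d + d) * V + (absR a * (d * V) + d * V) =
  d * (2 * (absR a + 1) * V) by ring.
by rewrite ler_wpM2l ?(ltW d0)// ler_wpM2l ?lerDl// mulr_ge0// addr_ge0.
Qed.

(** The sets where [u n] exceeds a level [h] decrease to the empty set, so their
    variation tends to 0; elsewhere the integrand is at most [h]. *)
Lemma integral_fun_smooth : smooth integral_fun.
Proof.
move=> u udec u0 e e0; have V0 := variationT_ge0.
have [B uB] := CbR_bounded (u 0%N).
have dec := decreasing_le udec.
have h0 : 0 < e / (6 * (V + 1)) by rewrite divr_gt0// mulr_gt0// ltr_wpDl.
have hE : e / (6 * (V + 1)) * (6 * (V + 1)) = e.
  by rewrite divfK// gt_eqF// mulr_gt0// ltr_wpDl.
move: h0 hE; set h := e / _ => h0 hE.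
pose E n := [set x | h < u n x].
have SE n : S (E n).
  apply: oS; have /continuousP/(_ [set y | h < y] (open_gt (y := h))) := @Cb_cts _ _ (u n).
  by [].
have dE n : E n.+1 `<=` E n by move=> x /lt_le_trans; apply; exact: udec.
have E0 : \bigcap_n E n = set0.
  rewrite -subset0 => x Ex; have [n hn] := u0 x h h0.
  by have := Ex n I; rewrite /E /= ltNge (ltW hn).
have Bh0 : 0 < B%:R + h by rewrite ltr_wpDl.
have [n hn] := variation_decr_cvg0 SE dE E0 (divr_gt0 (divr_gt0 e0 (ltr0n R 2)) Bh0).
rewrite ltr_pdivlMr// in hn.
exists n => f fu.
have [T [q [c [mq hq]]]] := quantize f h0.
have h1 := integral_funP (ltW h0) mq hq.
have cu x : absR (c (q x)) <= u n x + h.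
  have := absR_dist (c (q x)) (f x) 0; rewrite !subr0 => /le_trans; apply.
  by rewrite addrC lerD// absRC.
have h2 : absR (simple_int q c) <= (h + h) * nu (~` E n) + (B%:R + h) * nu (~` ~` E n).
  apply: simple_int_le => //.
  - exact: sigmaC.
  - by rewrite addr_ge0// ltW.
  - exact: ltW.
  - move=> x /negP; rewrite -leNgt => uh.
    by rewrite (le_trans (cu x))// lerD2r.
  - move=> x _; rewrite (le_trans (cu x))// lerD2r (le_trans (dec 0%N n x _))//.
    by rewrite (le_trans (ler_norm _)).
have h3 : nu (~` E n) <= V by apply: variation_mono => //; [exact: sigmaC|exact: sigmaT].
have := absR_dist (integral_fun f) (simple_int q c) 0; rewrite !subr0 => /le_trans; apply.
rewrite setCK in h2; have := variation_ge0 (sigmaC (SE n)).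
move: h1 h2 h3 hn; set a := nu (E n); set b := nu (~` _) => *; nra.
Qed.

Lemma integral_fun_has_integral (f : Cb K X) : has_integral S mu f (integral_fun f).
Proof.
move=> e /gt0_ofR[eE]; move: (reK e) eE => r -> {e} r0; have V0 := variationT_ge0.
have d0 : 0 < r / (V + 1) by rewrite divr_gt0// ltr_wpDl.
have dE : r / (V + 1) * (V + 1) = r by rewrite divfK// gt_eqF// ltr_wpDl.
move: d0 dE; set d := r / _ => d0 dE.
have [T [q [c [mq hq]]]] := quantize f d0.
have h1 := integral_funP (ltW d0) mq hq.
exists #|T|, (fun i => q @^-1` [set enum_val i]), (fun i => c (enum_val i)); split.
- split; first by move=> i; exact: mq.
    by move=> i j _ _ [x [/= qi qj]]; apply: enum_val_inj; rewrite -qi.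
  apply/seteqP; split => // x _; exists (enum_rank (q x)) => //=.
  by rewrite enum_rankK.
- move=> i x /= <-; rewrite normK ler_ofR (le_trans (hq x))// -dE.
  by rewrite ler_peMr ?(ltW d0)// lerDr.
- rewrite normK ler_ofR.
  rewrite -(@big_enum_val _ _ _ _ {: T} (fun t => c t * mu (q @^-1` [set t]))).
  rewrite (le_trans h1)// -[leRHS]dE ler_wpM2l ?(ltW d0)// lerDl//.
Qed.

End scalar_measure.


(** * Lipschitz regularisation *)

Section inf_convolution.
Variables (R : realType) (X : topologicalType) (P : polish_data R X).
Local Notation d := (dist P).
Variables (u : X -> R) (B : R).
Hypothesis uB : forall x, `|u x| <= B.

(** The greatest [n]-Lipschitz minorant of [u]. *)
Definition infconv (n : nat) (x : X) : R :=
  inf [set v | exists y, v = u y + n%:R * d x y].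

Lemma infconv_has_inf n x : has_inf [set v | exists y, v = u y + n%:R * d x y].
Proof.
split; first by exists (u x + n%:R * d x x); exists x.
exists (- B) => _ [y ->]; have := uB y; rewrite ler_norml => /andP[h _].
by rewrite (le_trans h)// lerDl mulr_ge0// dist_ge0.
Qed.

Lemma infconv_le n x y : infconv n x <= u y + n%:R * d x y.
Proof. by apply: ge_inf; [exact: (infconv_has_inf n x).2|exists y]. Qed.

Lemma le_infconv n x v : (forall y, v <= u y + n%:R * d x y) -> v <= infconv n x.
Proof.
move=> h; apply: lb_le_inf; first exact: (infconv_has_inf n x).1.
by move=> _ [y ->].
Qed.

Lemma infconv_le_fun n x : infconv n x <= u x.
Proof. by rewrite (le_trans (infconv_le n x x))// dist_xx mulr0 addr0. Qed.

Lemma infconv_bounded n x : `|infconv n x| <= B.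
Proof.
rewrite ler_norml (le_trans (infconv_le_fun n x)) ?andbT; last first.
  by have := uB x; rewrite ler_norml => /andP[].
apply: le_infconv => y; have := uB y; rewrite ler_norml => /andP[h _].
by rewrite (le_trans h)// lerDl mulr_ge0// dist_ge0.
Qed.

Lemma infconv_lipschitz n x x' : `|infconv n x - infconv n x'| <= n%:R * d x x'.
Proof.
have h a b : infconv n a - n%:R * d a b <= infconv n b.
  apply: le_infconv => y; have := infconv_le n a y.
  have : n%:R * d a y <= n%:R * (d a b + d b y) by rewrite ler_wpM2l// dist_triangle.
  by rewrite mulrDr; lra.
have := h x x'; have := h x' x; rewrite (dist_sym P x' x) ler_norml => *.
by apply/andP; split; lra.
Qed.

Lemma infconv_incr n x : infconv n x <= infconv n.+1 x.
Proof.
apply: le_infconv => y; rewrite (le_trans (infconv_le n x y))// lerD2l.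
by rewrite ler_wpM2r ?dist_ge0// ler_nat.
Qed.

(** Points far from [x] are too expensive once [n] times their distance exceeds
    the oscillation [2 * B]; near [x] continuity bounds [u] from below. *)
Lemma infconv_approx x e : 0 < e -> {for x, continuous u} ->
  exists n, u x - e <= infconv n x.
Proof.
move=> e0 /cvgrPdist_lt/(_ e e0)/(nbhs_dist P)[r r0 hr].
have [n hn] : exists n, 2 * B <= n%:R * r.
  exists (Num.truncn (2 * B / r)).+1; rewrite -ler_pdivrMr// ltW//.
  exact: truncnS_gt.
exists n; apply: le_infconv => y.
have [dxy|dxy] := ltP (d x y) r.
  have := hr y dxy; rewrite ltr_norml => /andP[h1 h2].
  have : 0 <= n%:R * d x y by rewrite mulr_ge0// dist_ge0.
  lra.
have : n%:R * r <= n%:R * d x y by rewrite ler_wpM2l.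
have := uB x; have := uB y; rewrite !ler_norml => /andP[h1 h2] /andP[h3 h4].
lra.
Qed.

Lemma infconv_bounded_continuous n : infconv n \in @bounded_continuous R X.
Proof.
apply: (@bounded_continuousR _ _ _ B); last exact: infconv_bounded.
exact: (lipschitz_continuous (infconv_lipschitz n)).
Qed.

End inf_convolution.

(** * Baire, Radon and k-regular measures *)

Section measures_on_polish.
Variables (R : realType) (k : scalar_kind) (X : topologicalType).
Variable P : polish_data R X.
Local Notation K := (scalars R k).
Local Notation d := (dist P).

(** An open set is the cozero set of the truncated distance to its complement,
    which is the regularised indicator function. *)
Lemma baire_borel : baire_sets R k X = borel_sets X.
Proof.
rewrite /baire_sets /borel_sets; congr smallest.
apply/seteqP; split => [A [f [U [cf oU ->]]]|A oA] /=.
  by move/continuousP: cf; exact.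
pose u x : R := (x \in A)%:R.
have u1 x : `|u x| <= 1 by rewrite /u; case: (x \in A); rewrite ?normr1 ?normr0.
exists (fun x => ofR (infconv P u 1 x)), (~` [set 0]).
split.
- move=> x; apply/cvgK => e e0.
  have cu := lipschitz_continuous (infconv_lipschitz P u1 1).
  have /cvgrPdist_lt/(_ e e0) := cu x.
  by apply: filterS => y; rewrite -ofRB absR_ofR distrC.
- rewrite openC; exact/accessible_closed_set1/hausdorff_accessible/norm_hausdorff.
- apply/seteqP; split => x /=.
    move=> Ax; have /(nbhs_dist P)[r r0 hr] := open_nbhs_nbhs (conj oA Ax).
    have : Num.min 1 r <= infconv P u 1 x.
      apply: (@le_infconv _ _ P u 1 u1) => y; rewrite mul1r /u.
      have [Ay|/negP Ay] := boolP (y \in A).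
        by rewrite ge_min lerDl dist_ge0.
      rewrite add0r ge_min; apply/orP; right; rewrite leNgt; apply/negP => /hr.
      by move=> /mem_set.
    move=> h h0; move: h; rewrite (@ofR_inj R k (infconv P u 1 x) 0) ?ofR0//.
    by rewrite ge_min !leNgt ltr01 r0.
  apply: contra_notP => nAx; rewrite -(@ofR0 R k); congr ofR.
  apply/eqP; rewrite eq_le; apply/andP; split.
    by rewrite (le_trans (infconv_le_fun P u1 1 x))// /u memNset.
  apply: (@le_infconv _ _ P u 1 u1) => y.
  by rewrite addr_ge0 ?mulr_ge0 ?dist_ge0// /u; case: (y \in A).
Qed.

Lemma sigma_borel : sigma_algebra setT (borel_sets X).
Proof. exact: smallest_sigma_algebra. Qed.

Lemma open_borel A : open A -> borel_sets X A.
Proof. by move=> oA; apply: sub_sigma_algebra. Qed.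

(** In a complete space an ultrafilter charging finite unions of arbitrarily
    small balls is a Cauchy filter, so it converges. *)
Lemma ultra_totally_bounded_cvg (F : set_system X) : UltraFilter F ->
  (forall e, 0 < e -> exists N, F [set x | exists2 y, y \in first_points P N & d y x <= e]) ->
  exists l : X, F --> l.
Proof.
move=> FU h; apply: (@dist_complete _ _ P F _) => e e0.
have e2 : 0 < e / 2 by rewrite divr_gt0.
have [N] := h _ e2; elim: (first_points P N) => [|y s IH].
  move=> F0; have [x [y]] := filter_ex F0.
  by rewrite in_nil.
move=> Fys; have [Fy|Fny] := in_ultra_setVsetC [set x | d y x < e] FU.
  by exists y.
apply: IH; apply: filterS (filterI Fys Fny) => x [[z]].
rewrite in_cons => /orP[/eqP -> dyx|zs dzx] /= nd; last by exists z.
by case: nd; rewrite (le_lt_trans dyx)//; lra.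
Qed.

Definition near_points (N : nat) (e : R) : set X :=
  [set x | exists2 y, y \in first_points P N & d y x <= e].

Lemma near_points_closed N e : closed (near_points N e).
Proof.
rewrite (_ : near_points N e = \bigcup_(y in [set` first_points P N]) [set x | d x y <= e]).
  by apply: closed_bigcup => [|y _]; [exact: finite_seq|exact: closed_dist_le].
by apply/seteqP; split => x [y ys dyx]; exists y => //=; move: dyx => /=; rewrite dist_sym.
Qed.

Lemma geometric_le2 n : \sum_(i < n) (2 ^+ i)^-1 <= 2 :> R.
Proof.
have pow0 m : (0 : R) < (2 ^+ m)^-1 by rewrite invr_gt0 exprn_gt0.
suff : \sum_(i < n) (2 ^+ i)^-1 <= 2 - (2 ^+ n)^-1 * 2 :> R by have := pow0 n; lra.
elim: n => [|n IH]; first by rewrite big_ord0 expr0 invr1 mul1r subrr.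
rewrite big_ord_recr /= exprS invfM; have := pow0 n; move: IH.
set a := (2 ^+ n)^-1; lra.
Qed.

(** Ulam: finitely many small balls carry almost all of the measure, for every
    radius; the intersection of these finite unions is compact by completeness. *)
Lemma borel_tight (mu : set X -> K) (e : R) : is_measure (borel_sets X) mu -> 0 < e ->
  exists2 C : set X, compact C & (scalar_variation (borel_sets X) mu (~` C) < e%:E)%E.
Proof.
move=> mmu e0; have sS := sigma_borel.
have pow0 n : (0 : R) < (2 ^+ n)^-1 by rewrite invr_gt0 exprn_gt0.
have Sc A : closed A -> borel_sets X A by exact: closed_sigma sS open_borel _.
have /choice[N hN] (n : nat) : exists N, variationR (borel_sets X) mu
    (~` near_points N (2 ^+ n)^-1) < e / 4 * (2 ^+ n)^-1.
  apply: (variation_decr_cvg0 sS mmu (E := fun N => ~` near_points N (2 ^+ n)^-1)).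
  - by move=> N; apply: (sigmaC sS); apply: Sc; exact: near_points_closed.
  - move=> N; apply: subsetC => x [y ys dyx]; exists y => //.
    by have [t ->] := first_pointsS P N; rewrite mem_cat ys.
  - rewrite -subset0 => x hx.
    have [N /(_ N (leqnn N))[y ys dxy]] := first_points_dense P x (pow0 n).
    by apply: (hx N I); exists y => //; rewrite dist_sym ltW.
  - by rewrite mulr_gt0// divr_gt0.
pose C := \bigcap_n near_points (N n) (2 ^+ n)^-1.
have cC : closed C by apply: closed_bigI => n _; exact: near_points_closed.
exists C.
  rewrite compact_ultra => F FU FC.
  have [|l Fl] := ultra_totally_bounded_cvg FU.
    move=> r r0; have [n _ /(_ n (leqnn n)) hn] := near_infty_natSinv_expn_lt (PosNum r0).
    exists (N n); apply: filterS FC => x /(_ n I)[y ys dyx]; exists y => //.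
    by rewrite (le_trans dyx)// ltW// -div1r.
  exists l; split => //; rewrite [C](closure_id C).1// => U Ul.
  exact: filter_ex (filterI FC (Fl U Ul)).
have SC : borel_sets X (~` C) by apply: (sigmaC sS); exact: Sc.
rewrite (variationE sS mmu)// lte_fin /C setC_bigcap.
apply: (@le_lt_trans _ _ (e / 2)); last lra.
apply: (variation_bigU_le sS mmu) => [n|n].
  by apply: (sigmaC sS); apply: Sc; exact: near_points_closed.
rewrite (@le_trans _ _ (\sum_(i < n) e / 4 * (2 ^+ i)^-1))//.
  by apply: ler_sum => i _; exact: ltW.
rewrite -mulr_sumr.
have := geometric_le2 n; set t := \sum_(_ < _) _; nra.
Qed.

Lemma baire_measureE (mu : set X -> K) :
  baire_measure mu <-> is_measure (borel_sets X) mu.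
Proof. by rewrite /baire_measure baire_borel. Qed.

Lemma baire_radon (mu : set X -> K) : baire_measure mu <-> radon_measure mu.
Proof.
split=> [/baire_measureE mmu|[mmu _]]; last exact/baire_measureE.
by split => // e e0; exact: borel_tight.
Qed.

Lemma baire_k_regular (mu : set X -> K) : baire_measure mu -> k_regular_measure mu.
Proof.
move=> bmu; split => //; have /baire_measureE mmu := bmu.
have [phi phiE Mphi] := smooth_Mspace P (integral_fun_scalar sigma_borel mmu open_borel)
  (integral_fun_smooth sigma_borel mmu open_borel).
exists phi => // f; rewrite baire_borel phiE; exact: integral_fun_has_integral.
Qed.

End measures_on_polish.


(** * Positive functionals *)

Section positive_functional.
Variables (R : realType) (k : scalar_kind) (X : topologicalType).
Local Notation K := (scalars R k).

Definition expect (psi : Cb K X -> K) (u : Cb R X) : R := reK (psi (ofCb k u)).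

Definition positive_fun (psi : Cb K X -> K) :=
  forall f : Cb K X, (forall x, 0 <= f x) -> 0 <= psi f.

Variable psi : Cb K X -> K.
Hypotheses (lin : scalar psi) (pos : positive_fun psi).
Local Notation E := (expect psi).
Implicit Types (u v : Cb R X) (f : Cb K X).

Lemma expectD u v : E (u + v) = E u + E v.
Proof. by rewrite /expect ofCbD (scalar_funD lin) reKD. Qed.
Lemma expectB u v : E (u - v) = E u - E v.
Proof. by rewrite /expect ofCbB (scalar_funB lin) reKB. Qed.
Lemma expectZ a u : E (a *: u) = a * E u.
Proof. by rewrite /expect ofCbZ (scalar_funZ lin) reK_ofRM. Qed.
Lemma expectN u : E (- u) = - E u.
Proof. by rewrite -scaleN1r expectZ mulN1r. Qed.
Lemma expect_sum (I : Type) (r : seq I) (u : I -> Cb R X) :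
  E (\sum_(i <- r) u i) = \sum_(i <- r) E (u i).
Proof.
elim: r => [|i r IH]; last by rewrite !big_cons expectD IH.
by rewrite !big_nil -(scale0r (0 : Cb R X)) expectZ mul0r.
Qed.

Lemma pos_ofCb u : (forall x, 0 <= u x) -> psi (ofCb k u) = ofR (E u) /\ 0 <= E u.
Proof.
move=> u0; have h : 0 <= psi (ofCb k u).
  by apply: pos => x; rewrite ofCbE -ofR0 ler_ofR.
have e := ge0_ofR h; split => //.
by move: h; rewrite e -ofR0 ler_ofR.
Qed.

Lemma expect_le u v : (forall x, u x <= v x) -> E u <= E v.
Proof.
move=> uv; rewrite -subr_ge0 -expectB.
by apply: (pos_ofCb _).2 => x; rewrite CbB subr_ge0.
Qed.

Lemma expect_ge0 u : (forall x, 0 <= u x) -> 0 <= E u.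
Proof. by move=> u0; exact: (pos_ofCb u0).2. Qed.

Lemma psi_ofCb u : psi (ofCb k u) = ofR (E u).
Proof.
have [N uN] := CbR_bounded u; pose c : Cb R X := N%:R *: Cb_one R X.
have c0 x : 0 <= c x by rewrite CbZ Cb_oneE mulr1.
have uc0 x : 0 <= (u + c) x.
  by rewrite CbD CbZ Cb_oneE mulr1; have := uN x; rewrite ler_norml => /andP[]; lra.
have -> : u = (u + c) - c by rewrite addrK.
by rewrite ofCbB (scalar_funB lin) (pos_ofCb uc0).1 (pos_ofCb c0).1 -ofRB expectB.
Qed.

Lemma psi_reim f : psi f = ofR (E (reCb f)) + jK * ofR (E (imCb f)).
Proof. by rewrite {1}(Cb_reim f) (scalar_funD lin) (scalar_funZ lin) !psi_ofCb. Qed.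

Lemma expect_abs_le u v : (forall x, `|u x| <= v x) -> `|E u| <= E v.
Proof.
move=> uv; rewrite ler_norml -expectN; apply/andP; split; apply: expect_le => x.
  by rewrite CbN; have := uv x; rewrite ler_norml => /andP[].
exact: le_trans (ler_norm _) (uv x).
Qed.

Lemma psi_abs_le f u : (forall x, absR (f x) <= u x) -> absR (psi f) <= 2 * E u.
Proof.
move=> fu; rewrite psi_reim (le_trans (absRD _ _))// absRM !absR_ofR mulr2n mulrDl mul1r.
rewrite lerD//; first by apply: expect_abs_le => x; rewrite (le_trans (reK_absR _)).
rewrite (@le_trans _ _ `|E (imCb f)|)//.
  by rewrite ler_piMl// absR_jK.
by apply: expect_abs_le => x; rewrite (le_trans (imK_absR _)).
Qed.

Lemma expect_smooth : smooth psi -> forall u : nat -> Cb R X,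
  (forall n x, 0 <= u n x) -> (forall n x, u n.+1 x <= u n x) ->
  (forall x e, 0 < e -> exists n, u n x < e) ->
  forall e, 0 < e -> exists n, E (u n) <= e.
Proof.
move=> sm u u0 udec ucvg e e0; have [n hn] := sm u udec ucvg e e0.
exists n; rewrite (le_trans (ler_norm _))// (le_trans (reK_absR _))//.
by apply: hn => x; rewrite ofCbE absR_ofR ger0_norm.
Qed.

End positive_functional.

Section comparison.
Variables (R : realType) (k : scalar_kind) (X : topologicalType).
Variable P : polish_data R X.
Local Notation K := (scalars R k).
Local Notation d := (dist P).
Variables phi psi : Cb K X -> K.
Hypotheses (lphi : scalar phi) (pphi : positive_fun phi).
Hypotheses (lpsi : scalar psi) (ppsi : positive_fun psi).

(** Both functionals are compared with their Dirac approximations, which are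
    governed by finitely many test functions. *)
Lemma compare_by_parts (r : R) (s : seq X) (f : Cb K X) (M : nat) (V : Cb R X) :
  0 < r -> (forall x, absR (f x) <= M%:R) ->
  (forall x y, d x y < 2 * r -> absR (f x - f y) <= V x) ->
  absR (phi f - psi f) <=
    2 * M%:R * (expect phi (rest P r s) + expect psi (rest P r s)) +
    2 * (expect phi V + expect psi V) +
    M%:R * \sum_(y <- s) `|expect phi (part P r s y) - expect psi (part P r s y)|.
Proof.
move=> r0 fM fV.
have h (chi : Cb K X -> K) : scalar chi -> positive_fun chi ->
    absR (chi f - dirac_sum P chi r s f) <=
      2 * M%:R * expect chi (rest P r s) + 2 * expect chi V.
  move=> lchi pchi; rewrite (dirac_sumE P lchi) (le_trans (absRD _ _))// lerD//.
    rewrite -mulrA -(expectZ lchi); apply: psi_abs_le => // x.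
    rewrite mulCbE absRM absR_ofR CbZ (ger0_norm (rest_ge0 _ _ _ r0)).
    by rewrite ler_wpM2r// rest_ge0.
  by apply: psi_abs_le => // x; apply: (osc_part_le _ r0) => y; exact: fV.
have h3 : absR (dirac_sum P phi r s f - dirac_sum P psi r s f) <=
    M%:R * \sum_(y <- s) `|expect phi (part P r s y) - expect psi (part P r s y)|.
  rewrite /dirac_sum -sumrB (le_trans (absR_sum _ _ _))// mulr_sumr ler_sum// => y _.
  rewrite -mulrBl absRM mulrC ler_pM ?absR_ge0//.
  by rewrite !psi_ofCb// -ofRB absR_ofR.
have h1 := h phi lphi pphi; have h2 := h psi lpsi ppsi.
have h4 := absR_dist (phi f) (dirac_sum P phi r s f) (psi f).
have h5 := absR_dist (dirac_sum P phi r s f) (dirac_sum P psi r s f) (psi f).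
rewrite (absRC (dirac_sum P psi r s f)) in h5.
by move: h1 h2 h3 h4 h5; rewrite !mulrDr; lra.
Qed.

End comparison.

(** * The space of probability measures *)

Section P_space.
Variables (R : realType) (k : scalar_kind) (X : topologicalType).
Variable P : polish_data R X.
Local Notation K := (scalars R k).
Local Notation d := (dist P).
Local Notation PX := (Pspace K X).
Implicit Types phi psi : PX.

Lemma P_set phi : Pset (set_val phi). Proof. exact: set_valP. Qed.
Lemma P_lin phi : scalar (P_int phi).
Proof. exact: (set_valP (set_val phi)). Qed.
Lemma P_pos phi : positive_fun (P_int phi).
Proof. by have [_ h _] := P_set phi. Qed.
Lemma P_one phi : P_int phi (Cb_one K X) = 1.
Proof. by have [_ _ h] := P_set phi. Qed.
Lemma P_smooth phi : smooth (P_int phi).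
Proof. exact: natural_dual_smooth. Qed.

Definition Ex phi : Cb R X -> R := expect (P_int phi).

Lemma Ex_one phi : Ex phi (Cb_one R X) = 1.
Proof. by rewrite /Ex /expect ofCb_one P_one -ofR1 reK_ofR. Qed.

Lemma P_ext phi psi : (forall f, P_int phi f = P_int psi f) -> phi = psi.
Proof.
move=> h; apply/val_inj/val_inj/continuousEP => f; exact: h.
Qed.

(** For Polish [X] membership in [M(X)] is equivalent to smoothness, so [P(X)]
    consists of the normalised positive smooth functionals. *)
Lemma P_of (psi : Cb K X -> K) : scalar psi -> smooth psi -> positive_fun psi ->
  psi (Cb_one K X) = 1 -> exists phi : PX, P_int phi = psi.
Proof.
move=> lin sm pos one; have [phi phiE Mphi] := smooth_Mspace P lin sm.
have Pphi : Pset phi by split => //; rewrite phiE.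
by exists (exist _ phi (mem_set Pphi)).
Qed.

Lemma P_int_continuous (f : Cb K X) : continuous (fun phi : PX => P_int phi f).
Proof.
move=> phi; apply: (@continuous_comp _ _ _ (fun p : PX => set_val p)
  (fun p => natural_dual_fun p f)).
  exact: initial_continuous.
apply: (@continuous_comp _ _ _ (fun p : natural_dual (Cb K X) => set_val p)
  (fun p => cmap_fun p f)).
  exact: initial_continuous.
exact: eval_Cmaps_continuous.
Qed.

Lemma Ex_cvg (I : Type) (F : set_system I) (FF : Filter F) (mu_ : I -> PX) (mu : PX) :
  weak_cvg F mu_ mu -> forall u e, 0 < e -> \forall i \near F, `|Ex (mu_ i) u - Ex mu u| < e.
Proof.
move=> h u e e0; have /cvgK/(_ e e0) := h (ofCb k u); apply: filterS => i.
by apply: le_lt_trans; rewrite /Ex /expect -reKB reK_absR.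
Qed.

Lemma near_all_seq (I : Type) (F : set_system I) (FF : Filter F) (T : eqType)
    (s : seq T) (Q : T -> I -> Prop) :
  (forall y, \forall i \near F, Q y i) -> \forall i \near F, forall y, y \in s -> Q y i.
Proof.
move=> h; elim: s => [|y s IH]; first by apply: filterE.
apply: filterS2 (h y) IH => i Qy Qs z; rewrite in_cons => /orP[/eqP -> //|]; exact: Qs.
Qed.

(** In the bound of [compare_by_parts] the terms for the limit are small by its
    smoothness, and the others follow by weak convergence against finitely many
    test functions; none of these depends on the member of the family. *)
Lemma weak_cvg_unif (I : Type) (F : set_system I) (FF : Filter F) (mu_ : I -> PX)
    (mu : PX) (L : set (Cb K X)) (M : nat) (e : R) : weak_cvg F mu_ mu ->
  (forall f, L f -> forall x, absR (f x) <= M%:R) -> equicts P L -> 0 < e ->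
  \forall i \near F, forall f, L f -> absR (P_int mu f - P_int (mu_ i) f) <= e.
Proof.
move=> /Ex_cvg w LM LE e0; have [V [Vdec V0 LV]] := oscillation_envelope LM LE.
have M1 : 0 < M%:R + 1 :> R by rewrite ltr_wpDl.
have Vge0 n x : L !=set0 -> 0 <= V n x.
  move=> [f Lf]; have := LV n f x x Lf; rewrite dist_xx subrr absR0; apply.
  by rewrite divr_gt0.
have [[f0 Lf0]|L0] := pselect (L !=set0); last first.
  by apply: filterE => i f Lf; case: L0; exists f.
have L0 : L !=set0 by exists f0.
have c0 : 0 < e / 16 by rewrite divr_gt0.
have [n hn] := expect_smooth (@P_smooth mu) (fun n x => Vge0 n x L0) Vdec V0 c0.
have r0 : (0 : R) < n.+1%:R^-1 by rewrite invr_gt0.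
have q0 : 0 < e / 16 / (M%:R + 1) by rewrite divr_gt0.
have [N hN] := expect_smooth (@P_smooth mu) (u := fun N => rest P n.+1%:R^-1 (first_points P N))
  (fun N x => rest_ge0 _ _ _ r0) (fun N x => rest_decr _ _ _ r0)
  (fun x e e0 => let: ex_intro N h := rest_eventually0 P x r0 in
     ex_intro _ N (eq_ind_r (fun t => t < e) e0 h)) q0.
set s := first_points P N in hN.
have p0 : 0 < e / 16 / (M%:R + 1) / (size s).+1%:R by rewrite divr_gt0.
have hp := @near_all_seq I F FF _ s _ (fun y => w (part P n.+1%:R^-1 s y) _ p0).
have hV := w (V n) _ c0.
have hR := w (rest P n.+1%:R^-1 s) _ q0.
near=> i => f Lf.
have fV x y : d x y < 2 * n.+1%:R^-1 -> absR (f x - f y) <= V n x by exact: LV.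
have := compare_by_parts (@P_lin mu) (@P_pos mu) (@P_lin (mu_ i))
  (@P_pos (mu_ i)) s r0 (LM f Lf) fV.
move=> /le_trans; apply.
have h1 : `|Ex (mu_ i) (V n) - Ex mu (V n)| < e / 16 by near: i.
have h2 : `|Ex (mu_ i) (rest P n.+1%:R^-1 s) - Ex mu (rest P n.+1%:R^-1 s)|
  < e / 16 / (M%:R + 1) by near: i.
have h3 : \sum_(y <- s) `|expect (P_int mu) (part P n.+1%:R^-1 s y)
    - expect (P_int (mu_ i)) (part P n.+1%:R^-1 s y)| <= e / 16 / (M%:R + 1).
  have hi : forall y, y \in s ->
      `|Ex (mu_ i) (part P n.+1%:R^-1 s y) - Ex mu (part P n.+1%:R^-1 s y)|
      < e / 16 / (M%:R + 1) / (size s).+1%:R by near: i.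
  rewrite (@le_trans _ _ (\sum_(y <- s) e / 16 / (M%:R + 1) / (size s).+1%:R))//.
    rewrite big_seq [leRHS]big_seq; apply: ler_sum => y ys.
    by rewrite distrC ltW// hi.
  rewrite big_const_seq count_predT iter_addr_0 -[_ *+ _]mulr_natr -mulrA ler_piMr//.
    exact: ltW.
  by rewrite mulrC ler_pdivrMr// mul1r ler_nat.
move: h1 h2; rewrite !ltr_norml => /andP[_ h1] /andP[_ h2].
rewrite -/(Ex mu) -/(Ex (mu_ i)) in h3 hn hN *.
have qE : e / 16 / (M%:R + 1) * (M%:R + 1) = e / 16 by rewrite divfK// gt_eqF.
move: qE q0 hN h2 h3; set q := _ / (M%:R + 1) => qE q0 hN h2 h3.
have Mq : M%:R * q <= e / 16 by rewrite -qE mulrDr mulr1 mulrC lerDl ltW.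
set a := Ex mu (rest _ _ _) in hN h2 *; set b := Ex (mu_ i) (rest _ _ _) in h2 *.
have h4 : M%:R * (a + b) <= M%:R * (3 * q) by rewrite ler_wpM2l//; lra.
have h5 := ler_wpM2l (ler0n R M) h3.
move: h1 hn h4 h5 Mq; lra.
Unshelve. all: by end_near. Qed.


Lemma Pspace_cvg_seq (mu_ : nat -> PX) (mu : PX) :
  weak_cvg \oo mu_ mu -> mu_ @ \oo --> mu.
Proof.
move=> w; apply: cvg_initial; apply: (natural_dual_cvg_seq (P := P)) => L M LM LE e e0.
exact: (weak_cvg_unif _ w LM LE e0).
Qed.

Lemma weak_cvgW (I : Type) (F : set_system I) (FF : Filter F) (mu_ : I -> PX) (mu : PX) :
  mu_ @ F --> mu -> weak_cvg F mu_ mu.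
Proof.
move=> h f; apply: (@cvg_comp _ _ _ mu_ (fun phi : PX => P_int phi f) _ _ _ h).
exact: P_int_continuous.
Qed.

Lemma weak_cvg_Ex (I : Type) (F : set_system I) (FF : Filter F) (mu_ : I -> PX) (mu : PX) :
  (forall u e, 0 < e -> \forall i \near F, `|Ex (mu_ i) u - Ex mu u| < e) ->
  weak_cvg F mu_ mu.
Proof.
move=> h f; apply/cvgK => e e0; have e2 : 0 < e / 2 by rewrite divr_gt0.
apply: filterS2 (h (reCb f) _ e2) (h (imCb f) _ e2) => i h1 h2.
rewrite !(psi_reim (@P_lin _) (@P_pos _)).
rewrite (_ : _ - _ = ofR (Ex (mu_ i) (reCb f) - Ex mu (reCb f)) +
  jK * ofR (Ex (mu_ i) (imCb f) - Ex mu (imCb f))); last first.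
  by rewrite !ofRB /Ex; ring.
rewrite (le_lt_trans (absRD _ _))// absRM !absR_ofR (splitr e) ltrD//.
by rewrite (le_lt_trans _ h2)// ler_piMl// absR_jK.
Qed.

(** * The bounded Lipschitz metric *)

Definition BL1 : set (Cb R X) :=
  [set u | (forall x, `|u x| <= 1) /\ forall x y, `|u x - u y| <= d x y].

Definition BL_values phi psi : set R :=
  [set v | exists2 u, BL1 u & v = `|Ex phi u - Ex psi u|].

Definition BL_dist phi psi : R := sup (BL_values phi psi).

Lemma Ex_le1 phi (u : Cb R X) : (forall x, `|u x| <= 1) -> `|Ex phi u| <= 1.
Proof.
move=> u1; rewrite -(Ex_one phi); exact: (expect_abs_le (@P_lin phi) (@P_pos phi)).
Qed.

Lemma BL1_0 : BL1 0.
Proof. by split => [x|x y]; rewrite ?CbB !Cb0 ?subrr normr0// dist_ge0. Qed.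

Lemma BL_has_sup phi psi : has_sup (BL_values phi psi).
Proof.
split; first by exists `|Ex phi 0 - Ex psi 0|, 0 => //; exact: BL1_0.
exists 2 => _ [u [u1 _] ->]; rewrite (le_trans (ler_normB _ _))//.
by rewrite -(natr1 1) lerD// Ex_le1.
Qed.

Lemma BL_dist_ub phi psi u : BL1 u -> `|Ex phi u - Ex psi u| <= BL_dist phi psi.
Proof. by move=> Lu; apply: sup_upper_bound; [exact: BL_has_sup|exists u]. Qed.

Lemma BL_dist_le phi psi c : (forall u, BL1 u -> `|Ex phi u - Ex psi u| <= c) ->
  BL_dist phi psi <= c.
Proof.
move=> h; apply: ge_sup; first exact: (BL_has_sup phi psi).1.
by move=> _ [u Lu ->]; exact: h.
Qed.

Lemma BL_dist_lipschitz phi psi (u : Cb R X) (C : R) : 0 < C ->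
  (forall x, `|u x| <= C) -> (forall x y, `|u x - u y| <= C * d x y) ->
  `|Ex phi u - Ex psi u| <= C * BL_dist phi psi.
Proof.
move=> C0 uC uL; have Ci : 0 < C^-1 by rewrite invr_gt0.
have Lu : BL1 (C^-1 *: u).
  split=> [x|x y]; rewrite ?CbZ.
    by rewrite normrM (gtr0_norm Ci) mulrC ler_pdivrMr// mul1r.
  by rewrite -mulrBr normrM (gtr0_norm Ci) mulrC ler_pdivrMr// mulrC.
have := BL_dist_ub phi psi Lu.
by rewrite /Ex !(expectZ (@P_lin _)) -mulrBr normrM (gtr0_norm Ci) mulrC ler_pdivrMr// mulrC.
Qed.

Lemma BL_dist_xx phi : BL_dist phi phi = 0.
Proof.
apply/eqP; rewrite eq_le; apply/andP; split.
  by apply: BL_dist_le => u _; rewrite subrr normr0.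
by have := BL_dist_ub phi phi BL1_0; rewrite subrr normr0.
Qed.

Lemma BL_dist_sym phi psi : BL_dist phi psi = BL_dist psi phi.
Proof.
by congr sup; apply/seteqP; split => _ [u Lu ->]; exists u => //; rewrite distrC.
Qed.

Lemma BL_dist_triangle psi phi chi :
  BL_dist phi chi <= BL_dist phi psi + BL_dist psi chi.
Proof.
apply: BL_dist_le => u Lu.
rewrite (le_trans (ler_distD (Ex psi u) _ _))// lerD//; exact: BL_dist_ub.
Qed.

Lemma lipschitz_approx (u : Cb R X) : exists (w : nat -> Cb R X) (C : nat -> R),
  [/\ forall n, 0 < C n /\ (forall x, `|w n x| <= C n) /\
        forall x y, `|w n x - w n y| <= C n * d x y,
      forall n x, w n x <= u x,
      forall n x, w n x <= w n.+1 x
    & forall x e, 0 < e -> exists n, u x - w n x < e].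
Proof.
have [N uN] := CbR_bounded u.
exists (fun n => MkCb (infconv_bounded_continuous P uN n)), (fun n => (N + n).+1%:R).
split=> /=.
- move=> n; split=> //; split=> [x|x y].
    by rewrite (le_trans (infconv_bounded P uN n x))// ler_nat ltnW// ltnS leq_addr.
  rewrite (le_trans (infconv_lipschitz P uN n x y))// ler_wpM2r ?dist_ge0//.
  by rewrite ler_nat ltnW// ltnS leq_addl.
- by move=> n x; exact: (infconv_le_fun P uN).
- by move=> n x; exact: (infconv_incr P uN).
- move=> x e e0; have e2 : 0 < e / 2 by rewrite divr_gt0.
  have [n hn] := infconv_approx P uN e2 (@Cb_cts _ _ u x).
  by exists n; move: hn; lra.
Qed.

Lemma Ex_lipschitz_approx phi (u : Cb R X) (e : R) : 0 < e ->
  exists (w : Cb R X) (C : R), [/\ 0 < C, (forall x, `|w x| <= C),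
    (forall x y, `|w x - w y| <= C * d x y), (forall x, w x <= u x)
    & Ex phi u - e <= Ex phi w].
Proof.
move=> e0; have [w [C [wC wu winc wcvg]]] := lipschitz_approx u.
have [n hn] : exists n, Ex phi (u - w n) <= e.
  apply: (expect_smooth (@P_smooth phi)) => //.
  - by move=> n x; rewrite CbB subr_ge0.
  - by move=> n x; rewrite !CbB lerD2l lerN2.
exists (w n), (C n); have [C0 [w1 w2]] := wC n; split=> //.
by move: hn; rewrite /Ex (expectB (@P_lin _)); lra.
Qed.

(** Lower semicontinuity, through a Lipschitz minorant of [u] with almost the same
    expectation under the limit; applied to [- u] as well it gives convergence. *)
Lemma BL_cvg_Ex_ge (I : Type) (F : set_system I) (FF : Filter F) (mu_ : I -> PX) (mu : PX) :
  (forall e, 0 < e -> \forall i \near F, BL_dist mu (mu_ i) < e) ->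
  forall u e, 0 < e -> \forall i \near F, Ex mu u - e < Ex (mu_ i) u.
Proof.
move=> h u e e0; have e2 : 0 < e / 2 by rewrite divr_gt0.
have [w [C [C0 wC wL wu hw]]] := Ex_lipschitz_approx mu u e2.
apply: filterS (h _ (divr_gt0 e2 C0)) => i; rewrite ltr_pdivlMr// mulrC => hi.
have := BL_dist_lipschitz mu (mu_ i) C0 wC wL.
have := expect_le (@P_lin (mu_ i)) (@P_pos (mu_ i)) wu.
rewrite -/(Ex (mu_ i)) ler_norml => h1 /andP[h2 h3].
by move: h1 h2 h3 hw hi; rewrite -/(Ex (mu_ i) _); lra.
Qed.

Lemma BL_cvg_weak (I : Type) (F : set_system I) (FF : Filter F) (mu_ : I -> PX) (mu : PX) :
  (forall e, 0 < e -> \forall i \near F, BL_dist mu (mu_ i) < e) -> weak_cvg F mu_ mu.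
Proof.
move=> h; apply: weak_cvg_Ex => u e e0.
apply: filterS2 (BL_cvg_Ex_ge FF h u e0) (BL_cvg_Ex_ge FF h (- u) e0) => i.
by rewrite /Ex !(expectN (@P_lin _)) ltr_norml => h1 h2; apply/andP; split; lra.
Qed.

(** The unit ball of bounded Lipschitz functions is equicontinuous. *)
Lemma weak_cvg_BL (I : Type) (F : set_system I) (FF : Filter F) (mu_ : I -> PX) (mu : PX) :
  weak_cvg F mu_ mu -> forall e, 0 < e -> \forall i \near F, BL_dist mu (mu_ i) < e.
Proof.
move=> w e e0; have e2 : 0 < e / 2 by rewrite divr_gt0.
pose L : set (Cb K X) := [set ofCb k u | u in BL1].
have LM f : L f -> forall x, absR (f x) <= 1%:R.
  by move=> [u [u1 _] <-] x; rewrite ofCbE absR_ofR.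
have LE : equicts P L.
  move=> x r r0; exists r => // _ y [u [_ uL] <-] dxy.
  by rewrite !ofCbE -ofRB absR_ofR (le_lt_trans (uL _ _)).
apply: filterS (weak_cvg_unif _ w LM LE e2) => i hi.
rewrite (@le_lt_trans _ _ (e / 2))//; last by lra.
apply: BL_dist_le => u Lu.
have := hi (ofCb k u) (ex_intro2 _ _ u Lu erefl).
by rewrite !(psi_ofCb (@P_lin _) (@P_pos _)) -ofRB absR_ofR.
Qed.

Lemma BL_dist_eq0 phi psi : BL_dist phi psi = 0 -> phi = psi.
Proof.
move=> h; apply: P_ext => f.
have w : weak_cvg \oo (fun _ : nat => psi) phi.
  by apply: BL_cvg_weak => e e0; apply: filterE => _; rewrite h.
apply/eqP; rewrite -subr_eq0; apply/eqP; apply: absR_small => e e0.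
have /cvgK/(_ e e0)[n _ /(_ n (leqnn n))] := w f.
by rewrite absRC => /ltW.
Qed.

(** Convergence in the k-topology has been established for sequences only. That
    suffices here: a neighbourhood containing no metric ball would be avoided by
    a sequence converging in the metric, hence weakly. *)
Lemma nbhs_Pspace (phi : PX) (U : set PX) :
  nbhs phi U <-> exists2 e, 0 < e & forall psi, BL_dist phi psi < e -> U psi.
Proof.
split=> [Uphi|[e e0 eU]].
  apply: contrapT => nh; have inv0 n : (0 : R) < n.+1%:R^-1 by rewrite invr_gt0.
  have /choice[m mP] (n : nat) : exists psi, BL_dist phi psi < n.+1%:R^-1 /\ ~ U psi.
    apply: contrapT => nf; apply: nh; exists n.+1%:R^-1 => // psi dpsi.
    by apply: contrapT => nU; apply: nf; exists psi.
  have : m @ \oo --> phi.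
    apply: Pspace_cvg_seq; apply: BL_cvg_weak => e e0.
    near=> n; rewrite (lt_trans (mP n).1)//; near: n.
    exact: (near_infty_natSinv_lt (PosNum e0)).
  by move=> /(_ U Uphi)[n _ /(_ n (leqnn n))]; exact: (mP n).2.
have w : weak_cvg (nbhs phi) id phi by apply: weak_cvgW; exact: cvg_id.
by apply: filterS (weak_cvg_BL _ w e0) => psi; exact: eU.
Unshelve. all: by end_near. Qed.

Lemma cvg_Pspace (I : Type) (F : set_system I) (FF : Filter F) (mu_ : I -> PX) (mu : PX) :
  mu_ @ F --> mu <-> weak_cvg F mu_ mu.
Proof.
split; first exact: weak_cvgW.
move=> w U /nbhs_Pspace[e e0 eU]; apply: filterS (weak_cvg_BL _ w e0) => i; exact: eU.
Qed.

End P_space.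


(** * Completeness *)

Section total_boundedness.
Variables (R : realType) (X : topologicalType) (P : polish_data R X).
Local Notation d := (dist P).

Definition dist_to (s : seq X) (x : X) : R := \big[Num.min/1]_(y <- s) d x y.

Lemma dist_to_ge0 s x : 0 <= dist_to s x.
Proof.
rewrite /dist_to; elim: s => [|y s IH]; first by rewrite big_nil.
by rewrite big_cons le_min dist_ge0.
Qed.

Lemma dist_to_le1 s x : dist_to s x <= 1.
Proof.
rewrite /dist_to; elim: s => [|y s IH]; first by rewrite big_nil.
by rewrite big_cons ge_min IH orbT.
Qed.

Lemma dist_to_lipschitz s a b : `|dist_to s a - dist_to s b| <= d a b.
Proof.
rewrite /dist_to; elim: s => [|y s IH]; first by rewrite !big_nil subrr normr0 dist_ge0.
rewrite !big_cons; have := dist_lipschitz P y a b; move: IH; rewrite !ler_norml.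
set p := \big[Num.min/1]_(y <- s) d a y; set q := \big[Num.min/1]_(y <- s) d b y.
move=> /andP[h1 h2] /andP[h3 h4].
by case: (leP (d a y) p) => ?; case: (leP (d b y) q) => ?; apply/andP; split; lra.
Qed.

Lemma dist_to_cat s t x : dist_to (s ++ t) x <= dist_to s x.
Proof.
rewrite /dist_to; elim: s => [|y s IH]; last first.
  by rewrite /= !big_cons le_min ge_min lexx /= ge_min IH orbT.
by rewrite big_nil /=; exact: dist_to_le1.
Qed.

Lemma dist_to_le s x y : y \in s -> dist_to s x <= d x y.
Proof.
rewrite /dist_to; elim: s => [//|z s IH]; rewrite in_cons big_cons => /orP[/eqP ->|ys].
  by rewrite ge_min lexx.
by rewrite ge_min IH// orbT.
Qed.

Lemma dist_to_lt s x e : e <= 1 -> dist_to s x < e -> exists2 y, y \in s & d x y < e.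
Proof.
move=> e1; rewrite /dist_to; elim: s => [|z s IH].
  by rewrite big_nil ltNge e1.
rewrite big_cons gt_min => /orP[h|/IH[y ys dy]].
  by exists z; rewrite ?mem_head.
by exists y => //; rewrite in_cons ys orbT.
Qed.

Fact dist_to_subproof s : dist_to s \in @bounded_continuous R X.
Proof.
apply: (@bounded_continuousR _ _ _ 1).
  apply: (@lipschitz_continuous _ _ P _ 1) => a b; rewrite mul1r.
  exact: dist_to_lipschitz.
by move=> x; rewrite ger0_norm ?dist_to_ge0 ?dist_to_le1.
Qed.

Definition gap (N : nat) : Cb R X := MkCb (dist_to_subproof (first_points P N)).

Lemma gapE N x : gap N x = dist_to (first_points P N) x. Proof. by []. Qed.

Lemma gap_decr N x : gap N.+1 x <= gap N x.
Proof. by rewrite !gapE; have [t ->] := first_pointsS P N; exact: dist_to_cat. Qed.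

Lemma gap_cvg0 x e : 0 < e -> exists N, gap N x < e.
Proof.
move=> e0; have [N /(_ N (leqnn N))[y ys dxy]] := first_points_dense P x e0.
by exists N; rewrite gapE (le_lt_trans (dist_to_le _ ys)).
Qed.

Lemma gap_BL1 N : BL1 P (gap N).
Proof.
split=> [x|x y]; last exact: dist_to_lipschitz.
by rewrite ger0_norm ?dist_to_ge0 ?dist_to_le1.
Qed.

(** Functions decreasing to 0 are eventually small except where some early gap
    function is not: otherwise points where they stay large and the gaps are
    small would have a cluster point, contradicting the convergence there. *)
Lemma decreasing_gap_bound (u : nat -> Cb R X) (N : nat -> nat) (B : nat) (e : R) :
  0 < e -> (forall x, u 0%N x <= B.+1%:R) -> (forall n x, u n.+1 x <= u n x) ->
  (forall x r, 0 < r -> exists n, u n x < r) ->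
  exists m, forall x, u m x <= e + B.+1%:R * \sum_(i < m) 2 ^+ i * gap (N i) x.
Proof.
move=> e0 uB udec u0; apply: contrapT => nh.
have /choice[y yP] m : exists y, e + B.+1%:R * \sum_(i < m) 2 ^+ i * gap (N i) y < u m y.
  apply: contrapT => nf; apply: nh; exists m => x; rewrite leNgt; apply/negP => h.
  by apply: nf; exists x.
have dec := decreasing_le udec.
have term0 i x : 0 <= 2 ^+ i * gap (N i) x.
  by rewrite mulr_ge0 ?exprn_ge0// gapE dist_to_ge0.
have pow0 n : (0 : R) < (2 ^+ n)^-1 by rewrite invr_gt0 exprn_gt0.
have small m i : (i < m)%N -> gap (N i) (y m) < (2 ^+ i)^-1.
  move=> im; have h := yP m; have h' := le_trans (dec 0%N m (y m) (leq0n m)) (uB (y m)).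
  have h2 : 2 ^+ i * gap (N i) (y m) <= \sum_(i < m) 2 ^+ i * gap (N i) (y m).
    rewrite (bigD1 (Ordinal im))//= lerDl; apply: sumr_ge0 => j _; exact: term0.
  have h3 : B.+1%:R * \sum_(i < m) 2 ^+ i * gap (N i) (y m) < B.+1%:R * 1.
    by rewrite mulr1; move: h h' e0; lra.
  rewrite ltr_pM2l// in h3.
  rewrite -[ltRHS]mul1r ltr_pdivlMr ?exprn_gt0// mulrC.
  exact: le_lt_trans h2 h3.
have [G [GU yG]] := ultraFilterLemma (fmap_proper_filter y eventually_filter).
have [|l Gl] := @ultra_totally_bounded_cvg _ _ P G GU.
  move=> r r0; have [n _ /(_ n (leqnn n)) hn] := near_infty_natSinv_expn_lt (PosNum r0).
  exists (N n); apply: yG; exists n.+1 => // m /= nm.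
  have p1 : (2 ^+ n)^-1 <= 1 :> R by rewrite invf_le1 ?exprn_gt0// exprn_ege1// ler1n.
  have := small m n nm; rewrite gapE => /(dist_to_lt p1)[z zs dz]; exists z => //.
  by rewrite dist_sym ltW// (lt_trans dz)// -div1r.
have [n hn] := u0 l e e0.
have G1 : G [set x | u n x < e].
  by apply: Gl; have /cvgr_lt : u n x @[x --> l] --> u n l by [exact: Cb_cts]; exact.
have G2 : G [set x | e < u n x].
  apply: yG; exists n => // m /= nm; rewrite (lt_le_trans _ (dec n m (y m) nm))//.
  rewrite (le_lt_trans _ (yP m))// lerDl mulr_ge0// sumr_ge0// => i _; exact: term0.
have [x [h1 h2]] := filter_ex (filterI G1 G2).
by move: h1; rewrite /= ltNge (ltW h2).
Qed.

End total_boundedness.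

Section completeness.
Variables (R : realType) (k : scalar_kind) (X : topologicalType).
Variable P : polish_data R X.
Local Notation K := (scalars R k).
Local Notation d := (dist P).
Local Notation PX := (Pspace K X).
Variable F : set_system PX.
Hypothesis FF : ProperFilter F.
Hypothesis cF : forall e, 0 < e -> exists phi, F [set psi | BL_dist P phi psi < e].

(** The gap functions are uniformly Lipschitz, so a BL-Cauchy filter is tight
    with respect to them. *)
Lemma cauchy_gap (e : R) : 0 < e ->
  exists N, \forall phi \near F, Ex phi (gap P N) < e.
Proof.
move=> e0; have e2 : 0 < e / 2 by rewrite divr_gt0.
have [phi hphi] := cF e2.
have e4 : 0 < e / 4 by rewrite divr_gt0.
have [N hN] := expect_smooth (@P_smooth _ _ _ phi)
  (fun N x => dist_to_ge0 P (first_points P N) x : 0 <= gap P N x)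
  (gap_decr P) (gap_cvg0 P) e4.
exists N; apply: filterS hphi => psi /= hpsi.
have := BL_dist_ub phi psi (gap_BL1 P N); rewrite ler_norml => /andP[h1 h2].
by move: hN h1 h2 hpsi; rewrite -/(Ex phi); lra.
Qed.

(** By [decreasing_gap_bound], [u n] is dominated by a small constant plus a
    combination of gap functions, whose expectations are small along [F]; the
    geometric weights keep the sum of these expectations below [e]. *)
Lemma cauchy_smooth (u : nat -> Cb R X) (e : R) : 0 < e ->
  (forall n x, u n.+1 x <= u n x) ->
  (forall x r, 0 < r -> exists n, u n x < r) ->
  exists n, \forall phi \near F, Ex phi (u n) <= e.
Proof.
move=> e0 udec u0; have [B uB] := CbR_bounded (u 0%N).
have uB1 x : u 0%N x <= B.+1%:R.
  by rewrite (le_trans (ler_norm _))// (le_trans (uB x))// ler_nat.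
have e2 : 0 < e / 2 by rewrite divr_gt0.
have q0 : 0 < e / 4 / B.+1%:R by rewrite !divr_gt0.
have /choice[N hN] i : exists N, \forall phi \near F,
    Ex phi (gap P N) < e / 4 / B.+1%:R * (2 ^+ i)^-1 * (2 ^+ i)^-1.
  by apply: cauchy_gap; rewrite !mulr_gt0 ?invr_gt0 ?exprn_gt0.
have [m hm] := @decreasing_gap_bound _ _ P u N B _ e2 uB1 udec u0; exists m.
have hall : \forall phi \near F, forall i : 'I_m,
    Ex phi (gap P (N i)) < e / 4 / B.+1%:R * (2 ^+ i)^-1 * (2 ^+ i)^-1.
  by apply: filter_forall => i; exact: hN.
apply: filterS hall => phi hphi.
pose v : Cb R X := (e / 2) *: Cb_one R X + B.+1%:R *: \sum_(i < m) 2 ^+ i *: gap P (N i).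
have uv x : u m x <= v x.
  rewrite /v CbD !CbZ Cb_oneE mulr1 Cb_sum; exact: hm.
rewrite (le_trans (expect_le (@P_lin _ _ _ phi) (@P_pos _ _ _ phi) uv))//.
rewrite /v (expectD (@P_lin _ _ _ phi)) !(expectZ (@P_lin _ _ _ phi)) -/(Ex phi) Ex_one mulr1.
rewrite /Ex (expect_sum (@P_lin _ _ _ phi)).
have : \sum_(i < m) expect (P_int phi) (2 ^+ i *: gap P (N i)) <=
    \sum_(i < m) e / 4 / B.+1%:R * (2 ^+ i)^-1.
  apply: ler_sum => i _; rewrite (expectZ (@P_lin _ _ _ phi)) mulrC.
  by rewrite -ler_pdivlMr ?exprn_gt0// ltW// hphi.
rewrite -mulr_sumr => h1.
have h2 : e / 4 / B.+1%:R * \sum_(i < m) (2 ^+ i)^-1 <= e / 4 / B.+1%:R * 2.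
  by rewrite ler_wpM2l ?(ltW q0)// geometric_le2.
have h3 := ler_wpM2l (ler0n R B.+1) (le_trans h1 h2).
have qE : B.+1%:R * (e / 4 / B.+1%:R * 2) = e / 2 by field.
rewrite qE in h3; move: h3; lra.
Qed.

(** [u] differs from a Lipschitz minorant [w n] by a term of a sequence decreasing
    to 0, and expectations of Lipschitz functions are Cauchy in the metric. *)
Lemma cauchy_Ex (u : Cb R X) (e : R) : 0 < e ->
  exists c, \forall phi \near F, `|Ex phi u - c| < e.
Proof.
move=> e0; have e4 : 0 < e / 4 by rewrite divr_gt0.
have [w [C [wC wu winc wcvg]]] := lipschitz_approx P u.
have [n hn] : exists n, \forall phi \near F, Ex phi (u - w n) <= e / 4.
  by apply: cauchy_smooth => // n x; rewrite !CbB lerD2l lerN2.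
have [C0 [w1 w2]] := wC n.
have [phi hphi] := cF (divr_gt0 e4 C0).
exists (Ex phi (w n)); apply: filterS2 hn hphi => psi h1 /= h2.
rewrite ltr_pdivlMr// mulrC in h2.
have := BL_dist_lipschitz phi psi C0 w1 w2; rewrite ler_norml => /andP[h3 h4].
have h5 := expect_le (@P_lin _ _ _ psi) (@P_pos _ _ _ psi) (wu n).
move: h1; rewrite /Ex (expectB (@P_lin _ _ _ psi)) -!/(Ex _ _) => h1.
rewrite -!/(Ex _ _) in h5.
by rewrite ltr_norml; apply/andP; split; lra.
Qed.

Lemma cauchy_limit_exists : exists psi : Cb K X -> K, forall f,
  (fun phi : PX => P_int phi f) @ F --> psi f.
Proof.
suff h f : exists l : K, (fun phi : PX => P_int phi f) @ F --> l.
  by have [psi hpsi] := choice h; exists psi.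
apply: K_complete => e e0; have e2 : 0 < e / 2 by rewrite divr_gt0.
have [a ha] := cauchy_Ex (reCb f) e2; have [b hb] := cauchy_Ex (imCb f) e2.
exists (ofR a + jK * ofR b); apply: filterS2 ha hb => phi h1 h2.
rewrite (psi_reim (@P_lin _ _ _ phi) (@P_pos _ _ _ phi)).
rewrite (_ : _ - _ = ofR (Ex phi (reCb f) - a) + jK * ofR (Ex phi (imCb f) - b)); last first.
  by rewrite !ofRB /Ex; ring.
rewrite (le_lt_trans (absRD _ _))// absRM !absR_ofR (splitr e) ltrD//.
by rewrite (le_lt_trans _ h2)// ler_piMl// absR_jK.
Qed.

Lemma K_ge0_limit (g : PX -> K) (z : K) : (forall phi, 0 <= g phi) -> g @ F --> z -> 0 <= z.
Proof.
move=> g0 /cvgK gz.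
have im0 : imK z = 0.
  apply/eqP; rewrite -normr_eq0 eq_le normr_ge0 andbT; apply/ler_addgt0Pr => e e0.
  rewrite add0r; have [phi hphi] := filter_ex (gz e e0).
  rewrite (le_trans _ (ltW hphi))// (le_trans _ (imK_absR _))// imKB.
  by rewrite (ge0_ofR (g0 phi)) imK_ofR sub0r normrN.
have re0 : 0 <= reK z.
  apply/ler_addgt0Pr => e e0; have [phi hphi] := filter_ex (gz e e0).
  have := le_trans (reK_absR _) (ltW hphi); rewrite reKB ler_norml => /andP[h1 h2].
  have : 0 <= reK (g phi) by rewrite -(ler_ofR k) ofR0 -(ge0_ofR (g0 phi)).
  by move: h2; lra.
by rewrite (K_decomp z) im0 ofR0 mulr0 addr0 -ofR0 ler_ofR.
Qed.

Lemma cauchy_cvg_Pspace : exists l : PX, F --> l.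
Proof.
have [psi psiP] := cauchy_limit_exists.
have hK : hausdorff_space K by exact: norm_hausdorff.
have lin : scalar psi.
  move=> a f g; apply: (cvg_unique hK (psiP (a *: f + g))).
  have : (fun phi : PX => a * P_int phi f + P_int phi g) @ F --> a * psi f + psi g.
    by apply: cvgD; [apply: cvgM; [exact: cvg_cst|exact: psiP]|exact: psiP].
  apply: cvg_trans; apply: near_eq_cvg; apply: filterE => phi.
  by rewrite (P_lin phi).
have pos : positive_fun psi.
  by move=> f f0; apply: K_ge0_limit (psiP f) => phi; exact: P_pos.
have one : psi (Cb_one K X) = 1.
  apply: (cvg_unique hK (psiP (Cb_one K X))).
  have : (fun _ : PX => 1 : K) @ F --> (1 : K) by exact: cvg_cst.
  by apply: cvg_trans; apply: near_eq_cvg; apply: filterE => phi; rewrite P_one.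
have sm : smooth psi.
  move=> u udec u0 e e0.
  have e4 : 0 < e / 4 by rewrite divr_gt0.
  have [n hn] := cauchy_smooth e4 udec u0; exists n => f fu.
  have e2 : 0 < e / 2 by rewrite divr_gt0.
  have /cvgK/(_ _ e2) hf := psiP f.
  have [phi [h1 h2]] := filter_ex (filterI hn hf).
  have h3 := psi_abs_le (@P_lin _ _ _ phi) (@P_pos _ _ _ phi) fu.
  have := absR_dist (psi f) (P_int phi f) 0; rewrite !subr0 => /le_trans; apply.
  by move: h1 h2 h3; rewrite /= absRC -/(Ex phi _); lra.
have [l lE] := P_of P lin sm pos one; exists l.
have := (cvg_Pspace P FF id l).2; apply; move=> f.
by rewrite lE; exact: psiP.
Qed.

End completeness.


(** * Separability of the space of measures *)

Section separability.
Variables (R : realType) (k : scalar_kind) (X : topologicalType).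
Variable P : polish_data R X.
Local Notation K := (scalars R k).
Local Notation d := (dist P).
Local Notation PX := (Pspace K X).

Lemma truncn_eq_dist (a b T : R) : 0 < T -> 0 <= a -> 0 <= b ->
  Num.truncn (T * a) = Num.truncn (T * b) -> `|a - b| <= T^-1.
Proof.
move=> T0 a0 b0 h.
have := truncn_itv (mulr_ge0 (ltW T0) a0); rewrite h.
have := truncn_itv (mulr_ge0 (ltW T0) b0); set n := Num.truncn _.
rewrite -addn1 natrD => /andP[h1 h2] /andP[h3 h4].
rewrite -[leRHS]mul1r ler_pdivlMr// -{1}(gtr0_norm T0) -normrM ler_norml.
by apply/andP; split; nra.
Qed.

(** Measures giving almost the same mass to each of finitely many tents, which
    carry almost all of the mass, are close; rounding these masses leaves only
    countably many classes, each of which needs one representative. *)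
Lemma Pspace_BL_separable : exists2 D : set PX, countable D &
  forall phi e, 0 < e -> exists2 psi, D psi & BL_dist P phi psi < e.
Proof.
pose r (j : nat) : R := j.+1%:R^-1.
have r0 j : 0 < r j by rewrite invr_gt0.
pose T j N : R := j.+1%:R * (size (first_points P N)).+1%:R.
have T0 j N : 0 < T j N by rewrite mulr_gt0.
pose mass (j N : nat) (phi : PX) :=
  [seq Num.truncn (T j N * Ex phi (part P (r j) (first_points P N) y))
  | y <- first_points P N].
pose cls (i : nat * nat * seq nat) : set PX :=
  [set phi | mass i.1.1 i.1.2 phi = i.2 /\
    Ex phi (rest P (r i.1.1) (first_points P i.1.2)) <= r i.1.1].
have [rep repP] : exists rep : nat * nat * seq nat -> option PX, forall i phi, cls i phi ->
    exists2 psi, rep i = Some psi & cls i psi.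
  suff h i : exists o : option PX, forall phi, cls i phi -> exists2 psi, o = Some psi & cls i psi.
    by have [rep hrep] := choice h; exists rep.
  have [[psi cpsi]|nc] := pselect (cls i !=set0); first by exists (Some psi) => phi _; exists psi.
  by exists None => phi cphi; case: nc; exists phi.
exists [set psi | exists i, rep i = Some psi].
  pose idx (psi : PX) : nat * nat * seq nat :=
    if pselect (exists i, rep i = Some psi) is left H then projT1 (cid H) else (0%N, 0%N, [::]).
  apply/countable_injP; exists (pickle \o idx) => phi psi.
  rewrite !inE /= => Dphi Dpsi /(pcan_inj pickleK).
  rewrite /idx; case: pselect => // H; case: pselect => // H'.
  by case: (cid H) => i /= hi; case: (cid H') => i' /= hi' ii'; move: hi; rewrite ii' hi' => -[].
move=> phi e e0.
have [j _ /(_ j (leqnn j)) hj] := near_infty_natSinv_lt (PosNum (divr_gt0 e0 (ltr0n R 20))).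
rewrite /= -/(r j) ltr_pdivlMr// in hj.
have [N hN] := expect_smooth (@P_smooth _ _ _ phi) (u := fun N => rest P (r j) (first_points P N))
  (fun N x => rest_ge0 _ _ _ (r0 j)) (fun N x => rest_decr _ _ _ (r0 j))
  (fun x e e0 => let: ex_intro N h := rest_eventually0 P x (r0 j) in
     ex_intro _ N (eq_ind_r (fun t => t < e) e0 h)) (r0 j).
set s := first_points P N in hN.
have [psi repi [/= mpsi rpsi]] := repP (j, N, mass j N phi) phi (conj erefl hN).
exists psi; first by exists (j, N, mass j N phi).
rewrite (@le_lt_trans _ _ (13 * r j))//; last by have := r0 j; lra.
apply: BL_dist_le => u [u1 uL].
have f1 x : absR (ofCb k u x) <= 1%:R by rewrite ofCbE absR_ofR.
have fV x y : d x y < 2 * r j -> absR (ofCb k u x - ofCb k u y) <= ((2 * r j) *: Cb_one R X) x.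
  by move=> dxy; rewrite !ofCbE -ofRB absR_ofR CbZ Cb_oneE mulr1 (le_trans (uL x y))// ltW.
have := compare_by_parts (@P_lin _ _ _ phi) (@P_pos _ _ _ phi) (@P_lin _ _ _ psi)
  (@P_pos _ _ _ psi) s (r0 j) f1 fV.
rewrite !(psi_ofCb (@P_lin _ _ _ _) (@P_pos _ _ _ _)) -ofRB absR_ofR => /le_trans; apply.
rewrite !(expectZ (@P_lin _ _ _ _)) -/(Ex phi) -/(Ex psi) !Ex_one.
have hs : \sum_(y <- s) `|Ex phi (part P (r j) s y) - Ex psi (part P (r j) s y)| <= r j.
  rewrite (@le_trans _ _ (\sum_(y <- s) (T j N)^-1))//.
    rewrite big_seq [leRHS]big_seq; apply: ler_sum => y ys.
    have pge0 (chi : PX) : 0 <= Ex chi (part P (r j) s y).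
      by apply: (expect_ge0 (@P_pos _ _ _ chi)) => x; exact: part_ge0.
    apply: truncn_eq_dist => //.
    by move/eq_in_map : mpsi => /(_ y ys).
  rewrite big_const_seq count_predT iter_addr_0 -[_ *+ _]mulr_natr /T invfM -/(r j) -mulrA.
  by rewrite ler_piMr ?(ltW (r0 j))// mulrC ler_pdivrMr// mul1r ler_nat.
move: hs hN rpsi; rewrite -/s -/(Ex phi); set a := Ex phi _; set b := Ex psi _; lra.
Qed.

End separability.

(** A copy of the space [P(X)], so that the structure induced by the metric does
    not compete with the topology that [P(X)] already carries. *)
Definition BL_Pspace (R : realType) (k : scalar_kind) (X : topologicalType)
  (P : polish_data R X) : Type := Pspace (scalars R k) X.

Section BL_metric.
Variables (R : realType) (k : scalar_kind) (X : topologicalType).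
Variable P : polish_data R X.

HB.instance Definition _ := Choice.on (BL_Pspace k P).
HB.instance Definition _ := isMetric.Build R (BL_Pspace k P)
  (@BL_dist_xx R k X P) (@BL_dist_eq0 R k X P) (@BL_dist_sym R k X P)
  (@BL_dist_triangle R k X P).

End BL_metric.

Lemma polish_Pspace (R : realType) (k : scalar_kind) (X : topologicalType)
  (P : polish_data R X) : polish R (Pspace (scalars R k) X).
Proof.
split.
  have [D cD hD] := Pspace_BL_separable k P; exists D => //.
  move=> U [phi Uphi] oU.
  have /(nbhs_Pspace P)[e e0 eU] := open_nbhs_nbhs (conj oU Uphi).
  by have [psi Dpsi h] := hD phi e e0; exists psi; split => //; exact: eU.
have nbhsE (phi : BL_Pspace k P) (U : set (BL_Pspace k P)) :
    nbhs phi U <-> exists2 e, 0 < e & forall psi, BL_dist P phi psi < e -> U psi.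
  split=> [/nbhs_ballP[e e0 eU]|[e e0 eU]].
    by exists e => // psi h; apply: eU; rewrite ballEmdist.
  by apply/nbhs_ballP; exists e => // psi; rewrite ballEmdist; exact: eU.
exists (BL_Pspace k P), id, id; split => //.
- by move=> phi U /nbhsE hU; apply/(nbhs_Pspace P).
- by move=> phi U /(nbhs_Pspace P) hU; apply/nbhsE.
- move=> F FF /cauchyP cF.
  have [e e0|l Fl] := @cauchy_cvg_Pspace R k X P F FF.
    by have [phi hphi] := cF e e0; exists phi; move: hphi; rewrite ballEmdist.
  exists l => U /nbhsE hU; apply: Fl; exact/(nbhs_Pspace P).
Qed.

Theorem proposition2p7p1 (R : realType) (k : scalar_kind) (X : topologicalType)
    (hX : polish R X) :
  [/\ (forall mu : set X -> scalars R k, baire_measure mu -> k_regular_measure mu),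
      [/\ baire_sets R k X = borel_sets X,
          (forall mu : set X -> scalars R k, baire_measure mu <-> radon_measure mu)
        & (forall mu : set X -> scalars R k,
             radon_measure mu <-> k_regular_measure mu)],
      (forall (I : Type) (F : set_system I) (FF : ProperFilter F)
         (mu_ : I -> Pspace (scalars R k) X) (mu : Pspace (scalars R k) X),
         mu_ @ F --> mu <-> weak_cvg F mu_ mu)
    & polish R (Pspace (scalars R k) X)].
Proof.
have [P _] := polish_dataP hX; split.
- exact: baire_k_regular.
- split; [exact: baire_borel|exact: baire_radon|move=> mu; split].
    by move=> /(baire_radon P); exact: baire_k_regular.
  by move=> [bmu _]; exact/(baire_radon P).
- by move=> I F FF mu_ mu; exact: (cvg_Pspace P).
- exact: polish_Pspace.
Qed.
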